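(* Let $\Omega\subset\mathbb{C}$ be a Carathéodory hyperbolic domain, let $n\geq 2$, let $F:\mathbb{D}\to S_n(\Omega)$ be a holomorphic map, and let $\zeta_1,\zeta_2\in\mathbb{D}$. Write $W_j=F(\zeta_j)$ for $j=1,2$, and for $\lambda\in\sigma(W_j)$ let $m_j(\lambda)$ denote the multiplicity of $\lambda$ as a zero of the minimal polynomial of $W_j$. Then \[ \max\left\{\max_{\mu\in\sigma(W_2)}\ \prod_{\lambda\in\sigma(W_1)}C_{\Omega}(\mu,\lambda)^{m_1(\lambda)},\ \ \max_{\lambda\in\sigma(W_1)}\ \prod_{\mu\in\sigma(W_2)}C_{\Omega}(\lambda,\mu)^{m_2(\mu)}\right\}\ \leq\ \left|\frac{\zeta_1-\zeta_2}{1-\overline{\zeta_2}\,\zeta_1}\right|. \]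
   Context: $\mathbb{D}$ is the open unit disc in $\mathbb{C}$ centered at $0$. $M_n(\mathbb{C})$ is the set of $n\times n$ complex matrices and $\sigma(A)$ denotes the set of (distinct) eigenvalues of $A$. For a domain $\Omega\subseteq\mathbb{C}$, $S_n(\Omega):=\{A\in M_n(\mathbb{C}):\sigma(A)\subset\Omega\}$, a domain in $M_n(\mathbb{C})\cong\mathbb{C}^{n^2}$. The Möbius distance on $\mathbb{D}$ is $\mathcal{M}_{\mathbb{D}}(z_1,z_2):=\left|\frac{z_1-z_2}{1-\overline{z_2}z_1}\right|$. The Carathéodory pseudo-distance on $\Omega$ is, in this normalization, $C_\Omega(p,q):=\sup\{\mathcal{M}_{\mathbb{D}}(f(p),f(q)): f:\Omega\to\mathbb{D}\text{ holomorphic}\}$. The domain $\Omega$ is called Carathéodory hyperbolic if $C_\Omega$ is a distance in the sense of metric spaces (equivalently, bounded holomorphic functions on $\Omega$ separate points of $\Omega$). *)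

(* Defs.v *)
From HB Require Import structures.
From mathcomp Require Import all_boot all_order all_algebra.
From mathcomp Require Import complex.
From mathcomp Require Import finmap.
From mathcomp Require Import boolp classical_sets functions cardinality.
From mathcomp Require Import reals topology normedtype derive.

Set Implicit Arguments.
Unset Strict Implicit.
Unset Printing Implicit Defensive.

Import Order.TTheory GRing.Theory Num.Theory.
Import numFieldNormedType.Exports.

Local Open Scope classical_set_scope.
Local Open Scope ring_scope.
Local Open Scope complex_scope.

(* The complex numbers are R[i] for R : realType. R[i] itself carries no
   canonical topology; the usual one (induced by the modulus) is found on its
   alias (R[i])^o, whence the casts in the next two definitions. *)

Definition is_domain (R : realType) (Omega : set R[i]) : Prop :=
  [/\ Omega !=set0, open (Omega : set (R[i])^o)
    & connected (Omega : set (R[i])^o)].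

(* Complex differentiability at every point of D, to be used for open D: the
   difference quotients h^-1 *: (f (z + h) - f z) converge in V as h tends to 0
   in R[i]. The values of f outside D are irrelevant. *)
Definition holomorphic_on (R : realType) (V : normedModType R[i])
    (D : set R[i]) (f : R[i] -> V) : Prop :=
  forall z : R[i], D z -> derivable (f : (R[i])^o -> V) z 1.

Definition unit_disc (R : realType) : set R[i] := [set z | `|z| < 1].
Arguments unit_disc R z : clear implicits.

(* normc is the modulus with values in R, whereas `|z| has type R[i]. *)
Definition mobius_dist (R : realType) (z1 z2 : R[i]) : R :=
  Normc.normc ((z1 - z2) / (1 - z2^* * z1)).

(* The supremum is over a nonempty set bounded by 1 when p and q are in Omega,
   so the real-valued sup is the genuine one. *)
Definition caratheodory (R : realType) (Omega : set R[i]) (p q : R[i]) : R :=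
  sup [set mobius_dist (f p) (f q) | f in
    [set f : R[i] -> (R[i])^o |
      holomorphic_on Omega f /\ f @` Omega `<=` unit_disc R]].

Definition is_distance_on (R : realType) (T : Type) (X : set T)
    (d : T -> T -> R) : Prop :=
  [/\ forall x y, X x -> X y -> 0 <= d x y,
      forall x y, X x -> X y -> (d x y = 0 <-> x = y),
      forall x y, X x -> X y -> d x y = d y x
    & forall x y z, X x -> X y -> X z -> d x z <= d x y + d y z].

Definition caratheodory_hyperbolic (R : realType) (Omega : set R[i]) : Prop :=
  is_distance_on Omega (caratheodory Omega).

Definition spectrum (R : realType) (n : nat) (A : 'M[R[i]]_n) : set R[i] :=
  [set a | eigenvalue A a].

Lemma finite_spectrum (R : realType) (n : nat) (A : 'M[R[i]]_n) :
  finite_set (spectrum A).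
Proof.
have [s sP] := closed_field_poly_normal (char_poly A).
apply: (@sub_finite_set _ _ [set` s]); last exact: finite_seq.
move=> a; rewrite /spectrum /= eigenvalue_root_char sP.
by rewrite (monicP (char_poly_monic A)) scale1r root_prod_XsubC.
Qed.

(* By finite_spectrum, fset_set (spectrum A) lists exactly the eigenvalues,
   each one once. *)
Definition eigenvalues (R : realType) (n : nat) (A : 'M[R[i]]_n) :
  {fset R[i]} := fset_set (spectrum A).

Definition S_ (R : realType) (n : nat) (Omega : set R[i]) : set 'M[R[i]]_n :=
  [set A | spectrum A `<=` Omega].
Arguments S_ {R} n Omega A.

Definition minpoly_mult (R : realType) (n : nat) (A : 'M[R[i]]_n.+1)
  (a : R[i]) : nat := mup a (mxminpoly A).

(* Main.v *)
Require Import Defs.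
From mathcomp Require Import all_boot all_order all_algebra.
From mathcomp Require Import complex finmap.
From mathcomp Require Import boolp classical_sets functions cardinality.
From mathcomp Require Import reals topology normedtype derive.
From mathcomp Require Import ring lra.
From mathcomp Require Import constructive_ereal measure lebesgue_measure.
From mathcomp Require Import lebesgue_integral.
From mathcomp Require Import sequences realfun exp trigo.

Import Order.TTheory GRing.Theory Num.Theory.
Import numFieldNormedType.Exports.
Import Normc.

Set Implicit Arguments.
Unset Strict Implicit.
Unset Printing Implicit Defensive.

Local Open Scope classical_set_scope.
Local Open Scope ring_scope.
Local Open Scope complex_scope.

Local Notation Re := (@complex.Re _).
Local Notation Im := (@complex.Im _).

(** Fix mu in the spectrum of W2. For each lambda in the spectrum of W1 choose a
    competitor f in the definition of the Caratheodory distance, and compose it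
    with an automorphism of the disc to get g_lambda with g_lambda(lambda) = 0.
    Let B be the product of the g_lambda ^ m1(lambda). It is enough to bound
    |B(mu)| by the Moebius distance M of zeta1 and zeta2; taking suprema over
    the competitors (prod_sup_le) and exchanging the two points then gives both
    halves of the statement.

    On Omega one has |B| <= K |q|, where q is the minimal polynomial of W1
    (blaschke_bound). The matrix q(F z) vanishes at zeta1, so q, and with it B,
    is O(|z - zeta1|) on the spectrum of F z (spectrum_near). Consider the power
    sums p_k(z) of the numbers B(x), for x running over the eigenvalues of F z
    with multiplicity. They are holomorphic in z, bounded independently of k,
    and vanish at zeta1 to order k. The argument of Schwarz's lemma gives
    |p_k(zeta2)| <= C rho ^ (k - 1) for every rho > M, with C independent of k.
    Finitely many numbers whose power sums grow like this lie in the closed disc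
    of radius rho (power_sum_bound); hence |B(mu)| <= M. This is
    spectral_schwarz.

    The power sums are holomorphic because the sum of any holomorphic h over the
    spectrum of F z is (cdiff_spectral_sum): near z0 it is the trace of Q(F z)
    up to o(|z - z0|), for a polynomial Q that agrees with h to high order at
    the eigenvalues of F z0. This takes Taylor expansions of h (taylor_bound),
    and the Schwarz argument takes a growth estimate for functions with an
    isolated singularity at which they stay continuous (cauchy_estimate). Both
    come from Cauchy's formula on circles, obtained by applying Goursat's
    theorem for rectangles in logarithmic coordinates, where circles around 0
    become vertical segments (goursat, cavg_annulus). *)

(** * The modulus *)

Section Modulus.
Context {R : realType}.
Implicit Types z w : R[i].

Lemma norm_normc z : `|z| = (normc z)%:C.
Proof. by []. Qed.

Lemma normc_ge0 z : 0 <= normc z.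
Proof. by case: z => a b; exact: sqrtr_ge0. Qed.

Lemma normcR (x : R) : normc x%:C = `|x|.
Proof. by rewrite /normc /= expr0n addr0 sqrtr_sqr. Qed.

Lemma normc_eq0 z : (normc z == 0) = (z == 0).
Proof. by apply/eqP/eqP => [/eq0_normc|->]; rewrite ?normc0. Qed.

Lemma normc_gt0 z : (0 < normc z) = (z != 0).
Proof. by rewrite lt_neqAle normc_ge0 andbT eq_sym normc_eq0. Qed.

Lemma normcX z k : normc (z ^+ k) = normc z ^+ k.
Proof. by elim: k => [|k IH]; rewrite ?normc1 // !exprS normcM IH. Qed.

Lemma normcB z w : normc (z - w) = normc (w - z).
Proof. by rewrite -normcN opprB. Qed.

Lemma ler_normcB z w : normc z - normc w <= normc (z - w).
Proof. by rewrite lerBlDr -{1}(subrK w z); exact: le_normcD. Qed.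

Lemma normcConj z : normc z^*%C = normc z.
Proof. by case: z => a b; rewrite /= sqrrN. Qed.

Lemma normc_Re z : `|Re z| <= normc z.
Proof.
by case: z => a b; rewrite /= -sqrtr_sqr ler_wsqrtr // lerDl sqr_ge0.
Qed.

Lemma normc_Im z : `|Im z| <= normc z.
Proof.
by case: z => a b; rewrite /= -sqrtr_sqr ler_wsqrtr // lerDr sqr_ge0.
Qed.

Lemma normc_le_ReIm z : normc z <= `|Re z| + `|Im z|.
Proof.
case: z => a b /=; rewrite -(@ger0_norm _ (`|a| + `|b|)) ?addr_ge0 //.
rewrite -sqrtr_sqr ler_wsqrtr // sqrrD !real_normK ?num_real //.
by rewrite lerD2r lerDl mulrn_wge0 // mulr_ge0.
Qed.

Lemma normc_sum (I : Type) (r : seq I) (P : pred I) (F : I -> R[i]) :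
  normc (\sum_(x <- r | P x) F x) <= \sum_(x <- r | P x) normc (F x).
Proof.
elim/big_rec2: _ => [|x y1 y2 _ IH]; first by rewrite normc0.
by apply: le_trans (le_normcD _ _) _; rewrite lerD2l.
Qed.

Lemma normc_prod (I : Type) (r : seq I) (P : pred I) (F : I -> R[i]) :
  normc (\prod_(x <- r | P x) F x) = \prod_(x <- r | P x) normc (F x).
Proof.
by elim/big_rec2: _ => [|x y1 y2 _ IH]; rewrite ?normc1 // normcM IH.
Qed.

End Modulus.

(** * Complex differentiability *)

Section Differentiability.
Context {R : realType}.
Implicit Types (f g : R[i] -> R[i]) (z w : R[i]).

(** Continuity at a point, wrapped as an inductive predicate so that comparing
    two such statements compares the functions and never unfolds the
    topologies. *)
Variant cont f z : Prop :=
  Cont of {for z, continuous (f : (R[i])^o -> (R[i])^o)}.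

Lemma contP f z : cont f z <-> forall e : R, 0 < e ->
  exists2 d : R, 0 < d &
    forall w, normc (w - z) < d -> normc (f w - f z) < e.
Proof.
split=> [[/cvgrPdist_lt fz] e e0|fz].
  have /fz /nbhs_ballP[d /= d0 H] : 0 < e%:C by rewrite ltcR.
  have dr : d = (Re d)%:C by rewrite RRe_real // gtr0_real.
  have rd0 : 0 < Re d by rewrite dr ltcR in d0.
  exists (Re d) => // w wz; have : ball (z : (R[i])^o) d w.
    by rewrite /ball /= dr norm_normc normcB ltcR.
  by move=> /H /=; rewrite norm_normc ltcR normcB.
split; apply/(@cvgrPdist_lt _ (R[i])^o _ (nbhs (z :
  (R[i])^o)) (nbhs_filter _) f) => e e0.
have er : e = (Re e)%:C by rewrite RRe_real // gtr0_real.
have re0 : 0 < Re e by rewrite er ltcR in e0.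
have [d d0 H] := fz _ re0; apply/nbhs_ballP; exists d%:C;
  first by rewrite /= ltcR.
move=> w; rewrite /ball /= norm_normc ltcR normcB => /H.
by rewrite {2}er norm_normc ltcR normcB.
Qed.

Lemma cont_cst (a : R[i]) z : cont (fun=> a) z.
Proof. by split; exact: cst_continuous. Qed.

Lemma cont_id z : cont id z.
Proof. by split=> A. Qed.

Lemma contD f g z : cont f z -> cont g z -> cont (fun w => f w + g w) z.
Proof.
by move=> [fz] [gz]; split;
  exact: (@cvgD _ (R[i])^o _ (nbhs (z : (R[i])^o)) _ f g _ _ fz gz).
Qed.

Lemma contM f g z : cont f z -> cont g z -> cont (fun w => f w * g w) z.
Proof.
by move=> [fz] [gz]; split;
  exact: (@cvgM _ _ (nbhs (z : (R[i])^o)) _ f g _ _ fz gz).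
Qed.

Lemma contN f z : cont f z -> cont (fun w => - f w) z.
Proof.
by move=> [fz]; split;
  exact: (@cvgN _ (R[i])^o _ (nbhs (z : (R[i])^o)) _ f _ fz).
Qed.

Lemma contB f g z : cont f z -> cont g z -> cont (fun w => f w - g w) z.
Proof. by move=> fz gz; exact: (contD fz (contN gz)). Qed.

Lemma contV f z : f z != 0 -> cont f z -> cont (fun w => (f w)^-1) z.
Proof.
by move=> fz0 [fz]; split;
  exact: (@cvgV _ _ (nbhs (z : (R[i])^o)) _ f _ fz0 fz).
Qed.

Lemma cont_comp f g z : cont f z -> cont g (f z) -> cont (fun w => g (f w)) z.
Proof.
by move=> [fz] [gz]; split;
  exact: (@continuous_comp (R[i])^o (R[i])^o (R[i])^o f g z fz gz).
Qed.

Lemma cont_near f g z (d : R) : 0 < d ->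
  (forall w, normc (w - z) < d -> f w = g w) -> cont f z -> cont g z.
Proof.
move=> d0 fg /contP fz; apply/contP => e e0.
have [d' d'0 H] := fz _ e0; exists (Num.min d d'); first by rewrite lt_min d0.
move=> w; rewrite lt_min => /andP[wd wd'].
by rewrite -!fg ?subrr ?normc0 //; exact: H.
Qed.

(** Caratheodory's form of complex differentiability: the slope of f at z
    extends to a function phi continuous at z, whose value there is the
    derivative. Products, inverses and compositions reduce to algebra on
    slopes. *)
Definition cdiff f z :=
  exists2 phi : R[i] -> R[i], cont phi z &
    forall w, f w = f z + phi w * (w - z).

Lemma cdiff_cont f z : cdiff f z -> cont f z.
Proof.
case=> phi cphi Hf; have -> : f = fun w => f z + phi w * (w - z).
  by apply/funext => w; exact: Hf.
apply: contD; first exact: cont_cst.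
by apply: contM => //; apply: contB; [exact: cont_id|exact: cont_cst].
Qed.

(** Away from z the slope can only be the difference quotient, so agreement
    near z is enough to keep its continuity at z. *)
Lemma cdiff_near f g z (d : R) : 0 < d ->
  (forall w, normc (w - z) < d -> f w = g w) -> cdiff f z -> cdiff g z.
Proof.
move=> d0 fg [phi cphi Hf].
exists (fun w => if w == z then phi z else (g w - g z) / (w - z)).
  apply: (cont_near d0 _ cphi) => w wd; case: eqVneq => [->//|wz].
  have gz : g z = f z by rewrite fg // subrr normc0.
  by rewrite -fg // gz Hf addrC addKr mulfK // subr_eq0.
move=> w; case: eqVneq => [->|wz]; first by rewrite subrr mulr0 addr0.
by rewrite divfK ?subr_eq0 // addrC subrK.
Qed.

Lemma cdiff_cst (a : R[i]) z : cdiff (fun=> a) z.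
Proof. by exists (fun=> 0); [exact: cont_cst|move=> w;
  rewrite mul0r addr0]. Qed.

Lemma cdiff_id z : cdiff id z.
Proof.
by exists (fun=> 1); [exact: cont_cst|move=> w; rewrite mul1r addrC subrK].
Qed.

Lemma cdiffD f g z : cdiff f z -> cdiff g z -> cdiff (fun w => f w + g w) z.
Proof.
case=> p cp Hf [q cq Hg]; exists (fun w => p w + q w); first exact: contD.
by move=> w; rewrite [in LHS]Hf [in LHS]Hg; ring.
Qed.

Lemma cdiffM f g z : cdiff f z -> cdiff g z -> cdiff (fun w => f w * g w) z.
Proof.
move=> df; have cf := cdiff_cont df; case: df => p cp Hf [q cq Hg].
exists (fun w => p w * g z + f w * q w).
  by apply: contD; apply: contM => //; exact: cont_cst.
move=> w; rewrite [in LHS]Hg mulrDr; rewrite [in X in X * g z]Hf.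
by ring.
Qed.

Lemma cdiffN f z : cdiff f z -> cdiff (fun w => - f w) z.
Proof.
case=> p cp Hf; exists (fun w => - p w); first exact: contN.
by move=> w; rewrite [in LHS]Hf; ring.
Qed.

Lemma cdiffB f g z : cdiff f z -> cdiff g z -> cdiff (fun w => f w - g w) z.
Proof. by move=> fz gz; apply: cdiffD => //; exact: cdiffN. Qed.

Lemma cdiffX f z k : cdiff f z -> cdiff (fun w => f w ^+ k) z.
Proof.
move=> fz; elim: k => [|k IH]; first exact: cdiff_cst.
by under eq_fun do rewrite exprS; exact: cdiffM.
Qed.

Lemma cdiff_sum (I : Type) (r : seq I) (F : I -> R[i] -> R[i]) z :
  (forall i, cdiff (F i) z) -> cdiff (fun w => \sum_(i <- r) F i w) z.
Proof.
move=> dF; elim: r => [|i r IH].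
  by under eq_fun do rewrite big_nil; exact: cdiff_cst.
by under eq_fun do rewrite big_cons; exact: cdiffD.
Qed.

Lemma cdiff_prod (I : Type) (r : seq I) (F : I -> R[i] -> R[i]) z :
  (forall i, cdiff (F i) z) -> cdiff (fun w => \prod_(i <- r) F i w) z.
Proof.
move=> dF; elim: r => [|i r IH].
  by under eq_fun do rewrite big_nil; exact: cdiff_cst.
by under eq_fun do rewrite big_cons; exact: cdiffM.
Qed.

Lemma cdiffV f z : f z != 0 -> cdiff f z -> cdiff (fun w => (f w)^-1) z.
Proof.
move=> fz0 df; have cf := cdiff_cont df; case: (df) => p cp Hf.
have /contP/(_ (normc (f z))) := cf.
rewrite normc_gt0 => /(_ fz0)[d d0 Hd].
have fw0 w : normc (w - z) < d -> f w != 0.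
  move=> /Hd H; apply: contraTneq H => ->.
  by rewrite sub0r normcN ltxx.
(* f may vanish far from z; there the inverse is replaced by the expression
   that has the expected slope. *)
apply: (@cdiff_near (fun w => if normc (w - z) < d then (f w)^-1
          else (f z)^-1 - p w / (f w * f z) * (w - z)) _ _ _ d0).
  by move=> w ->.
exists (fun w => - (p w / (f w * f z))).
  apply: contN; apply: contM => //; apply: contV; first by rewrite mulf_neq0.
  by apply: contM => //; exact: cont_cst.
move=> w; rewrite subrr normc0 d0; case: ifP => [/fw0 fw|_];
  last by rewrite mulNr.
have -> : - (p w / (f w * f z)) * (w - z) = - ((f w - f z) / (f w * f z)).
  by rewrite (Hf w); ring.
by field; rewrite fz0 fw.
Qed.

Lemma cdiff_comp f g z : cdiff f z -> cdiff g (f z) ->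
  cdiff (fun w => g (f w)) z.
Proof.
move=> df; have cf := cdiff_cont df; case: df => p cp Hf [q cq Hg].
exists (fun w => q (f w) * p w); first by apply: contM => //; exact: cont_comp.
by move=> w; rewrite [in LHS]Hg [in X in X - f z]Hf; ring.
Qed.

Lemma cdiff_horner (p : {poly R[i]}) z : cdiff (fun w => p.[w]) z.
Proof.
elim/poly_ind: p => [|p c IH].
  by under eq_fun do rewrite horner0; exact: cdiff_cst.
under eq_fun do rewrite hornerD hornerM hornerX hornerC.
by apply: cdiffD; [apply: cdiffM => //; exact: cdiff_id|exact: cdiff_cst].
Qed.

Lemma cdiff_lip f z : cdiff f z -> exists2 d : R, 0 < d & exists2 K : R, 0 < K &
  forall w, normc (w - z) < d -> normc (f w - f z) <= K * normc (w - z).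
Proof.
case=> p /contP/(_ 1 ltr01)[d d0 H] Hf.
exists d => //; exists (normc (p z) + 1).
  by rewrite ltr_wpDl // normc_ge0.
move=> w wd; rewrite (Hf w) addrC addKr normcM.
apply: ler_wpM2r; first exact: normc_ge0.
by rewrite -lerBlDl; apply: le_trans (ltW (H _ wd)); exact: ler_normcB.
Qed.

Lemma cdiff_eps f z (l : R[i]) :
  (forall e : R, 0 < e -> exists2 d : R, 0 < d & forall w, normc (w - z) < d ->
     normc (f w - f z - l * (w - z)) <= e * normc (w - z)) ->
  cdiff f z.
Proof.
move=> H; exists (fun w => if w == z then l else (f w - f z) / (w - z));
  last first.
  move=> w; case: eqVneq => [->|wz]; first by rewrite subrr mulr0 addr0.
  by rewrite divfK ?subr_eq0 // addrC subrK.
apply/contP => e e0; have e20 : 0 < e / 2 by rewrite divr_gt0.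
have [d d0 Hd] := H _ e20; exists d => // w wd; rewrite eqxx.
case: eqVneq => [_|wz]; first by rewrite subrr normc0.
have wz0 : w - z != 0 by rewrite subr_eq0.
have -> : (f w - f z) / (w - z) - l = (f w - f z - l * (w - z)) / (w - z).
  by rewrite [in RHS]mulrBl mulfK.
rewrite normcM normcV ltr_pdivrMr ?normc_gt0 //.
apply: le_lt_trans (Hd _ wd) _; rewrite ltr_pM2r ?normc_gt0 //.
by rewrite ltr_pdivrMr // ltr_pMr // ltr1n.
Qed.

End Differentiability.

Section Bridge.
Context {R : realType}.

Lemma derivable_cdiff (f : R[i] -> R[i]) z :
  derivable (f : (R[i])^o -> (R[i])^o) z 1 -> cdiff f z.
Proof.
move=> /cvg_ex[/= l /cvgrPdist_lt H]; apply: (@cdiff_eps _ _ _ l) => e e0.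
have /H /nbhs_ballP[d /= d0 Hd] : 0 < e%:C by rewrite ltcR.
have dr : d = (Re d)%:C by rewrite RRe_real // gtr0_real.
have rd0 : 0 < Re d by rewrite dr ltcR in d0.
exists (Re d) => // w wz; have [->|nwz] := eqVneq w z.
  by rewrite !subrr mulr0 subr0 normc0 mulr0.
have wz0 : w - z != 0 by rewrite subr_eq0.
have : ball (0 : (R[i])^o) d (w - z).
  by rewrite /ball /= dr sub0r norm_normc normcN ltcR.
move=> /Hd /(_ wz0); rewrite norm_normc ltcR => /ltW.
have -> : (w - z) *: (1 : (R[i])^o) + z = w
  by rewrite /GRing.scale /= mulr1 subrK.
move=> H1; have -> : f w - f z - l * (w - z) =
    - (l - (w - z)^-1 *: ((f w : (R[i])^o) - f z)) * (w - z).
  by rewrite /GRing.scale /= ; field.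
by rewrite normcM normcN ler_wpM2r ?normc_ge0.
Qed.

Lemma derivable_mx_entry m n (F : R[i] -> 'M[R[i]]_(m.+1, n.+1)) z i j :
  derivable (F : (R[i])^o -> _) z 1 -> cdiff (fun w => F w i j) z.
Proof.
move=> /cvg_ex[/= l Hl]; apply: derivable_cdiff; apply/cvg_ex; exists (l i j).
have := cvg_comp _ _ Hl (@coord_continuous _ _ _ i j l).
by apply: cvg_trans; apply: near_eq_cvg; near=> h; rewrite /= !mxE.
Unshelve. all: by end_near. Qed.

End Bridge.

(** * Integrals over a segment *)

Section ComplexIntegral.
Context {R : realType}.
Implicit Types (f g : R -> R[i]) (a b x : R).

Variant rcont f x : Prop := RCont of {for x, continuous (f : R -> (R[i])^o)}.

Lemma rcont_cst (c : R[i]) x : rcont (fun=> c) x.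
Proof. by split; exact: cst_continuous. Qed.

Lemma rcontD f g x : rcont f x -> rcont g x -> rcont (fun w => f w + g w) x.
Proof.
by move=> [fx] [gx]; split;
  exact: (@cvgD _ (R[i])^o _ (nbhs x) _ f g _ _ fx gx).
Qed.

Lemma rcontM f g x : rcont f x -> rcont g x -> rcont (fun w => f w * g w) x.
Proof.
by move=> [fx] [gx]; split; exact: (@cvgM _ _ (nbhs x) _ f g _ _ fx gx).
Qed.

Lemma rcont_comp f (h : R[i] -> R[i]) x :
  rcont f x -> cont h (f x) -> rcont (fun w => h (f w)) x.
Proof.
by move=> [fx] [hx]; split;
  exact: (@continuous_comp R (R[i])^o (R[i])^o f h x fx hx).
Qed.

Lemma continuous_Re : continuous (fun z : (R[i])^o => Re z : R^o).
Proof.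
move=> z; apply/(@cvgrPdist_lt _ R^o _ (nbhs (z :
  (R[i])^o)) (nbhs_filter _)) => e e0.
have : 0 < e%:C by rewrite ltcR.
move=> e0'; apply/nbhs_ballP; exists e%:C => // w; rewrite /ball /=.
rewrite norm_normc ltcR; apply: le_lt_trans.
by rewrite -raddfB; exact: normc_Re.
Qed.

Lemma continuous_Im : continuous (fun z : (R[i])^o => Im z : R^o).
Proof.
move=> z; apply/(@cvgrPdist_lt _ R^o _ (nbhs (z :
  (R[i])^o)) (nbhs_filter _)) => e e0.
have : 0 < e%:C by rewrite ltcR.
move=> e0'; apply/nbhs_ballP; exists e%:C => // w; rewrite /ball /=.
rewrite norm_normc ltcR; apply: le_lt_trans.
by rewrite -raddfB; exact: normc_Im.
Qed.

Lemma rcont_Re f x : rcont f x -> {for x, continuous (fun y => Re (f y) : R^o)}.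
Proof.
by move=> [fx]; apply: (@continuous_comp R (R[i])^o R^o f _ x fx);
  exact: continuous_Re.
Qed.

Lemma rcont_Im f x : rcont f x -> {for x, continuous (fun y => Im (f y) : R^o)}.
Proof.
by move=> [fx]; apply: (@continuous_comp R (R[i])^o R^o f _ x fx);
  exact: continuous_Im.
Qed.

Lemma rcont_ReIm f x : {for x, continuous (fun y => Re (f y) : R^o)} ->
  {for x, continuous (fun y => Im (f y) : R^o)} -> rcont f x.
Proof.
move=> /cvgrPdist_lt fr /cvgrPdist_lt fi; split;
  apply/(@cvgrPdist_lt _ (R[i])^o _ (nbhs x) _ f) => e e0.
have er : e = (Re e)%:C by rewrite RRe_real // gtr0_real.
have re0 : 0 < Re e / 2 by rewrite divr_gt0 //; rewrite er ltcR in e0.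
near=> y; rewrite er norm_normc ltcR; apply: le_lt_trans (normc_le_ReIm _) _.
rewrite !raddfB /= (splitr (Re e)); apply: ltrD; near: y; [exact: fr|exact: fi].
Unshelve. all: by end_near. Qed.

Definition cont_itv a b f := forall x, a <= x <= b -> rcont f x.

Local Notation mu := (@lebesgue_measure R).

Definition cint a b f : R[i] :=
  Rintegral mu `[a, b] (fun x => Re (f x)) +i*
  Rintegral mu `[a, b] (fun x => Im (f x)).

Lemma integrable_conton (h : R -> R) a b :
  (forall x, a <= x <= b -> {for x, continuous (h : R -> R^o)}) ->
  mu.-integrable `[a, b] (EFin \o h).
Proof.
move=> ch; apply: continuous_compact_integrable; first exact: segment_compact.
apply: continuous_in_subspaceT => x /set_mem /= xab; apply: ch.
by move: xab; rewrite in_itv.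
Qed.

Lemma integrable_Re f a b : cont_itv a b f ->
  mu.-integrable `[a, b] (EFin \o (fun x => Re (f x))).
Proof. by move=> cf; apply: integrable_conton => x xab; exact/rcont_Re/cf. Qed.

Lemma integrable_Im f a b : cont_itv a b f ->
  mu.-integrable `[a, b] (EFin \o (fun x => Im (f x))).
Proof. by move=> cf; apply: integrable_conton => x xab; exact/rcont_Im/cf. Qed.

Lemma eq_cint f g a b : (forall x, a <= x <= b -> f x = g x) ->
  cint a b f = cint a b g.
Proof.
move=> fg; congr (_ +i* _); apply: eq_Rintegral => x /set_mem /=;
  by rewrite in_itv /= => /fg ->.
Qed.

Lemma cintD f g a b : cont_itv a b f -> cont_itv a b g ->
  cint a b (fun x => f x + g x) = cint a b f + cint a b g.
Proof.
move=> cf cg; rewrite /cint; simpc; congr (_ +i* _).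
  rewrite -RintegralD //; [|exact: integrable_Re..].
  by apply: eq_Rintegral => x _; case: (f x) (g x) => ? ? [].
rewrite -RintegralD //; [|exact: integrable_Im..].
by apply: eq_Rintegral => x _; case: (f x) (g x) => ? ? [].
Qed.

Lemma cintZ (c : R[i]) f a b : cont_itv a b f ->
  cint a b (fun x => c * f x) = c * cint a b f.
Proof.
move=> cf; case: c => p q; rewrite /cint; simpc.
have iR k : mu.-integrable `[a, b] (EFin \o (fun x => k * Re (f x))).
  apply: integrable_conton => x xab; apply: cvgMl_tmp.
  exact: (rcont_Re (cf x xab)).
have iI k : mu.-integrable `[a, b] (EFin \o (fun x => k * Im (f x))).
  apply: integrable_conton => x xab; apply: cvgMl_tmp.
  exact: (rcont_Im (cf x xab)).
have ReM (z w : R[i]) : Re (z * w) = Re z * Re w - Im z * Im w.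
  by case: z w => ? ? [].
have ImM (z w : R[i]) : Im (z * w) = Re z * Im w + Im z * Re w.
  by case: z w => ? ? [].
congr (_ +i* _).
  rewrite -!RintegralZl //; [|exact: integrable_Im|exact: integrable_Re].
  by rewrite -RintegralB //; apply: eq_Rintegral => x _; rewrite ReM.
rewrite -!RintegralZl //; [|exact: integrable_Re|exact: integrable_Im].
by rewrite -RintegralD //; apply: eq_Rintegral => x _; rewrite ImM.
Qed.

Lemma cint_cst (c : R[i]) a b : a <= b -> cint a b (fun=> c) = c * (b - a)%:C.
Proof.
move=> ab; case: c => p q; rewrite /cint !Rintegral_cst //=.
by rewrite lebesgue_measure_itv /= lte_fin; case: ltP => [?|ba];
  [rewrite -EFinB /=|have -> : a = b by apply/eqP; rewrite eq_le ab];
  simpc; rewrite ?subrr ?mulr0.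
Qed.

Lemma Rintegral_split (h : R -> R) a b c : a <= c <= b ->
  mu.-integrable `[a, b] (EFin \o h) ->
  Rintegral mu `[a, b] h = Rintegral mu `[a, c] h + Rintegral mu `[c, b] h.
Proof.
move=> /andP[ac cb] ih; apply/eqP; rewrite addrC -subr_eq; apply/eqP.
rewrite Rintegral_itvB ?bnd_simp // Rintegral_itv_obnd_cbnd //.
apply: integrableS ih => //; apply: subset_itvr.
by rewrite bnd_simp.
Qed.

Lemma cint_split f a b c : a <= c <= b -> cont_itv a b f ->
  cint a b f = cint a c f + cint c b f.
Proof.
move=> acb cf; rewrite /cint; simpc.
by rewrite -!Rintegral_split //; [exact: integrable_Im|exact: integrable_Re].
Qed.

Lemma Rintegral_bound (h : R -> R) a b M : a <= b ->
  (forall x, a <= x <= b -> {for x, continuous (h : R -> R^o)}) ->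
  (forall x, a <= x <= b -> `|h x| <= M) ->
  `|Rintegral mu `[a, b] h| <= M * (b - a).
Proof.
move=> ab ch hM; have ih := integrable_conton ch.
apply: le_trans (le_normr_Rintegral _ ih) _ => //.
have -> : M * (b - a) = Rintegral mu `[a, b] (fun=> M).
  rewrite Rintegral_cst //= lebesgue_measure_itv /= lte_fin.
  case: ltP => [?|ba]; first by rewrite -EFinB.
  by have -> : a = b; [apply/eqP; rewrite eq_le ab|rewrite subrr].
apply: le_Rintegral => //.
- apply: (@integrable_conton (fun x => `|h x|)) => x xab.
  exact: (@cvg_norm _ R^o _ (nbhs x) _ h _ (ch x xab)).
- by apply: (@integrable_conton (fun=> M)) => x xab; exact: cst_continuous.
Qed.

(** Real and imaginary parts are bounded separately, which costs a factor 2.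
    Such a factor is harmless: the bound is used up to an arbitrary constant,
    or to show that something is arbitrarily small. *)
Lemma cint_bound f a b M : a <= b -> cont_itv a b f ->
  (forall x, a <= x <= b -> normc (f x) <= M) ->
  normc (cint a b f) <= 2 * M * (b - a).
Proof.
move=> ab cf fM; apply: le_trans (normc_le_ReIm _) _.
rewrite -mulrA mulr_natl mulr2n; apply: lerD;
  apply: Rintegral_bound => // x xab.
- exact/rcont_Re/cf.
- exact: le_trans (normc_Re _) (fM _ xab).
- exact/rcont_Im/cf.
- exact: le_trans (normc_Im _) (fM _ xab).
Qed.

End ComplexIntegral.

(** * Goursat's theorem on rectangles *)

Section Bisection.
Context {R : realType}.
Implicit Types a b c d s t e : R.

Lemma halving_lt (x e : R) : 0 < e -> exists n : nat, x / 2 ^+ n < e.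
Proof.
move=> e0; exists (Num.bound `|x / e|); set n := Num.bound _.
have h : `|x / e| < n%:R by apply: archi_boundP.
have n2 : n%:R <= 2 ^+ n :> R by rewrite -natrX ler_nat ltnW // ltn_expl.
rewrite ltr_pdivrMr ?exprn_gt0 // mulrC -ltr_pdivrMr //.
exact: le_lt_trans (ler_norm _) (lt_le_trans h n2).
Qed.

Lemma nested_point (u v : nat -> R) : (forall n, u n <= u n.+1) ->
  (forall n, v n.+1 <= v n) -> (forall n, u n <= v n) ->
  exists x, forall n, u n <= x <= v n.
Proof.
move=> /nondecreasing_seqP ui /nonincreasing_seqP vd uv.
have uvmn m n : u m <= v n.
  have [mn|/ltnW nm] := leqP m n; first exact: le_trans (ui _ _ mn) (uv n).
  exact: le_trans (uv m) (vd _ _ nm).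
have ub : has_ubound (range u) by exists (v 0%N) => _ [m _ <-].
have ne : range u !=set0 by exists (u 0%N), 0%N.
exists (sup (range u)) => n; apply/andP; split.
  by apply: ub_le_sup => //; exists n.
by apply: ge_sup => // _ [m _ <-].
Qed.

(** A rectangle on which P fails has a quarter on which P fails. The nested
    failing quarters shrink to a point, and the local hypothesis at that point
    is contradicted. *)
Lemma bisection (P : R -> R -> R -> R -> Prop) a0 b0 c0 d0 :
  (forall a b c d, a <= b -> c <= d ->
     P a ((a + b) / 2) c ((c + d) / 2) -> P ((a + b) / 2) b c ((c + d) / 2) ->
     P a ((a + b) / 2) ((c + d) / 2) d -> P ((a + b) / 2) b ((c + d) / 2) d ->
     P a b c d) ->
  (forall s t, a0 <= s <= b0 -> c0 <= t <= d0 ->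
     exists2 e, 0 < e & forall a b c d, a <= s <= b -> c <= t <= d ->
       b - a < e -> d - c < e -> P a b c d) ->
  a0 <= b0 -> c0 <= d0 -> P a0 b0 c0 d0.
Proof.
move=> Psplit Ploc ab0 cd0; apply: contrapT => nP.
pose bad (Q : R * R * R * R) :=
  [/\ Q.1.1.1 <= Q.1.1.2, Q.1.2 <= Q.2 & ~ P Q.1.1.1 Q.1.1.2 Q.1.2 Q.2].
pose half (Q Q' : R * R * R * R) :=
  [/\ Q.1.1.1 <= Q'.1.1.1, Q'.1.1.2 <= Q.1.1.2, Q.1.2 <= Q'.1.2, Q'.2 <= Q.2 &
      Q'.1.1.2 - Q'.1.1.1 = (Q.1.1.2 - Q.1.1.1) / 2 /\
      Q'.2 - Q'.1.2 = (Q.2 - Q.1.2) / 2].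
have step Q : exists Q', bad Q -> bad Q' /\ half Q Q'.
  case: Q => [[[a b] c] d].
  have [[/= ab cd nPQ]|nb] := pselect (bad (a, b, c, d));
    last by exists (a, b, c, d).
  have [P1|n1] := pselect (P a ((a + b) / 2) c ((c + d) / 2)); last first.
    exists (a, ((a + b) / 2), c, ((c + d) / 2)); rewrite /bad /half /=.
    by move=> _; repeat (split => //); lra.
  have [P2|n2] := pselect (P ((a + b) / 2) b c ((c + d) / 2)); last first.
    exists (((a + b) / 2), b, c, ((c + d) / 2)); rewrite /bad /half /=.
    by move=> _; repeat (split => //); lra.
  have [P3|n3] := pselect (P a ((a + b) / 2) ((c + d) / 2) d); last first.
    exists (a, ((a + b) / 2), ((c + d) / 2), d); rewrite /bad /half /=.
    by move=> _; repeat (split => //); lra.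
  exists (((a + b) / 2), b, ((c + d) / 2), d); rewrite /bad /half /=.
  move=> _; repeat (split => //); try lra.
  by move=> P4; apply: nPQ; apply: Psplit.
have [f Hf] := choice step.
pose Q n := iter n f (a0, b0, c0, d0).
have badQ n : bad (Q n).
  by elim: n => [|n IH]; [split|have [] := Hf _ IH].
have halfQ n : half (Q n) (Q n.+1) by have [] := Hf _ (badQ n).
have size1 n : (Q n).1.1.2 - (Q n).1.1.1 = (b0 - a0) / 2 ^+ n.
  elim: n => [|n IH]; first by rewrite expr0 divr1.
  have [_ _ _ _ [-> _]] := halfQ n.
  by rewrite IH exprSr invfM mulrA.
have size2 n : (Q n).2 - (Q n).1.2 = (d0 - c0) / 2 ^+ n.
  elim: n => [|n IH]; first by rewrite expr0 divr1.
  have [_ _ _ _ [_ ->]] := halfQ n.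
  by rewrite IH exprSr invfM mulrA.
have [s Hs] : exists x, forall n, (Q n).1.1.1 <= x <= (Q n).1.1.2.
  by apply: nested_point => n; [case: (halfQ n)|case: (halfQ n)|case: (badQ n)].
have [t Ht] : exists x, forall n, (Q n).1.2 <= x <= (Q n).2.
  by apply: nested_point => n; [case: (halfQ n)|case: (halfQ n)|case: (badQ n)].
have [e e0 He] := Ploc s t (Hs 0%N) (Ht 0%N).
have [n Hn] := halving_lt (Num.max (b0 - a0) (d0 - c0)) e0.
have n20 : 0 < (2 ^+ n)^-1 :> R by rewrite invr_gt0 exprn_gt0.
have [_ _ bQ] := badQ n; apply: bQ; apply: He => //.
- rewrite size1; apply: le_lt_trans Hn; rewrite ler_pM2r //.
  by rewrite le_max lexx.
- rewrite size2; apply: le_lt_trans Hn; rewrite ler_pM2r //.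
  by rewrite le_max lexx orbT.
Qed.

End Bisection.

Section Goursat.
Context {R : realType}.
Implicit Types (a b c d s t : R) (f g : R[i] -> R[i]).

Lemma rcont_hor c s : rcont (fun s => s +i* c) s.
Proof. by apply: rcont_ReIm; [move=> A|exact: cst_continuous]. Qed.

Lemma rcont_ver a t : rcont (fun t => a +i* t) t.
Proof. by apply: rcont_ReIm; [exact: cst_continuous|move=> A]. Qed.

Definition cdiff_rect g a b c d := forall s t, a <= s <= b -> c <= t <= d ->
  cdiff g (s +i* t).

Definition cont_rect g a b c d := forall s t, a <= s <= b -> c <= t <= d ->
  cont g (s +i* t).

Lemma cdiff_rect_cont g a b c d : cdiff_rect g a b c d -> cont_rect g a b c d.
Proof. by move=> dg s t sab tcd; apply/cdiff_cont/dg. Qed.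

Lemma cont_itv_hor g a b c d t : cont_rect g a b c d -> c <= t <= d ->
  cont_itv a b (fun s => g (s +i* t)).
Proof.
by move=> cg tcd s sab; apply: rcont_comp; [exact: rcont_hor|exact: cg].
Qed.

Lemma cont_itv_ver g a b c d s : cont_rect g a b c d -> a <= s <= b ->
  cont_itv c d (fun t => g (s +i* t)).
Proof.
by move=> cg sab t tcd; apply: rcont_comp; [exact: rcont_ver|exact: cg].
Qed.

(** The contour integral of g along the boundary of the rectangle with sides
    a <= s <= b and c <= t <= d, counterclockwise. *)
Definition rect_int g a b c d : R[i] :=
  cint a b (fun s => g (s +i* c)) - cint a b (fun s => g (s +i* d)) +
  'i * (cint c d (fun t => g (b +i* t)) - cint c d (fun t => g (a +i* t))).

Lemma rect_intD f g a b c d : a <= b -> c <= d ->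
  cont_rect f a b c d -> cont_rect g a b c d ->
  rect_int (fun z => f z + g z) a b c d = rect_int f a b c d + rect_int g a b
    c d.
Proof.
move=> ab cd cf cg; rewrite /rect_int !cintD; first ring.
all: by (apply: cont_itv_hor; eauto; rewrite ?lexx ?ab ?cd) ||
        (apply: cont_itv_ver; eauto; rewrite ?lexx ?ab ?cd).
Qed.

(** On opposite sides the integrals of the moving coordinate are equal and
    cancel; the contributions of the fixed coordinates cancel between the two
    pairs of sides. *)
Lemma rect_int_affine (p q : R[i]) a b c d : a <= b -> c <= d ->
  rect_int (fun z => p + q * z) a b c d = 0.
Proof.
move=> ab cd; rewrite /rect_int.
have hor t : cint a b (fun s => p + q * (s +i* t)) =
    (p + q * ('i * t%:C)) * (b - a)%:C + q * cint a b (fun s => s%:C).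
  rewrite (@eq_cint _ _ (fun s => (p + q * ('i * t%:C)) + q * s%:C)).
    rewrite cintD ?cintZ ?cint_cst // => s _; first exact: rcont_hor.
      exact: rcont_cst.
    by apply: rcontM; [exact: rcont_cst|exact: rcont_hor].
  by move=> s _; rewrite -addrA -mulrDr; congr (_ + _ * _); simpc.
have ver s : cint c d (fun t => p + q * (s +i* t)) =
    (p + q * s%:C) * (d - c)%:C + q * cint c d (fun t => 0 +i* t).
  rewrite (@eq_cint _ _ (fun t => (p + q * s%:C) + q * (0 +i* t))).
    rewrite cintD ?cintZ ?cint_cst // => t _; first exact: rcont_ver.
      exact: rcont_cst.
    by apply: rcontM; [exact: rcont_cst|exact: rcont_ver].
  by move=> t _; rewrite -addrA -mulrDr; congr (_ + _ * _); simpc.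
by rewrite !hor !ver !rmorphB /=; ring.
Qed.

Lemma rect_int_bound g a b c d M : a <= b -> c <= d -> cont_rect g a b c d ->
  (forall s t, a <= s <= b -> c <= t <= d -> normc (g (s +i* t)) <= M) ->
  normc (rect_int g a b c d) <= 4 * M * ((b - a) + (d - c)).
Proof.
move=> ab cd cg gM; rewrite /rect_int.
have lc : c <= c <= d by rewrite lexx. have ld : c <= d <= d by rewrite lexx cd.
have la : a <= a <= b by rewrite lexx. have lb : a <= b <= b by rewrite lexx ab.
have i1 : normc ('i : R[i]) = 1 by rewrite /= expr0n expr1n add0r sqrtr1.
apply: le_trans (le_normcD _ _) _; rewrite normcM i1 mul1r.
have H1 := cint_bound ab (cont_itv_hor cg lc) (fun s sab => gM s c sab lc).
have H2 := cint_bound ab (cont_itv_hor cg ld) (fun s sab => gM s d sab ld).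
have H3 := cint_bound cd (cont_itv_ver cg la) (fun t tcd => gM a t la tcd).
have H4 := cint_bound cd (cont_itv_ver cg lb) (fun t tcd => gM b t lb tcd).
have D1 := le_normcD (cint a b (fun s => g (s +i* c)))
   (- cint a b (fun s => g (s +i* d))).
have D2 := le_normcD (cint c d (fun t => g (b +i* t)))
   (- cint c d (fun t => g (a +i* t))).
by rewrite normcN in D1; rewrite normcN in D2; lra.
Qed.

Lemma rect_int_split4 g a b c d m n : a <= m <= b -> c <= n <= d ->
  cont_rect g a b c d ->
  rect_int g a b c d = rect_int g a m c n + rect_int g m b c n + rect_int g a
    m n d + rect_int g m b n d.
Proof.
move=> mab ncd cg; have [am mb] := andP mab; have [cn nd] := andP ncd.
have lc : c <= c <= d by rewrite lexx (le_trans cn).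
have ld : c <= d <= d by rewrite lexx (le_trans cn).
have la : a <= a <= b by rewrite lexx (le_trans am).
have lb : a <= b <= b by rewrite lexx (le_trans am).
rewrite /rect_int (cint_split mab (cont_itv_hor cg lc)).
rewrite (cint_split mab (cont_itv_hor cg ld)).
rewrite (cint_split ncd (cont_itv_ver cg la)) (cint_split ncd (cont_itv_ver cg
  lb)).
by ring.
Qed.

(** Near a point the affine part of g has integral 0 and the remainder is
    small compared with the size l = (b - a) + (d - c), so the integral is at
    most e l ^ 2. This bound is compatible with quartering, because the
    squared sizes of the four quarters add up to l ^ 2. *)
Lemma goursat g a b c d : a <= b -> c <= d -> cdiff_rect g a b c d ->
  rect_int g a b c d = 0.
Proof.
move=> ab cd dg.
suff H (e : R) : 0 < e ->
  normc (rect_int g a b c d) <= e * ((b - a) + (d - c)) ^+ 2.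
  apply: eq0_normc; apply/eqP; rewrite eq_le normc_ge0 andbT.
  apply/ler_addgt0Pr => e e0; rewrite add0r.
  have l0 : 0 <= ((b - a) + (d - c)) ^+ 2 by rewrite sqr_ge0.
  have e'0 : 0 < e / (1 + ((b - a) + (d - c)) ^+ 2).
    by rewrite divr_gt0 // ltr_wpDr.
  apply: le_trans (H _ e'0) _; rewrite mulrAC ler_pdivrMr ?ltr_wpDr //.
  by rewrite ler_pM2l // lerDr.
move=> e0; pose P a b c d := cdiff_rect g a b c d ->
  normc (rect_int g a b c d) <= e * ((b - a) + (d - c)) ^+ 2.
suff : P a b c d by exact.
apply: bisection => // {ab cd}.
  move=> {dg}a {}b {}c {}d ab cd P1 P2 P3 P4 dg.
  have mab : a <= (a + b) / 2 <= b by lra.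
  have ncd : c <= (c + d) / 2 <= d by lra.
  rewrite (rect_int_split4 mab ncd (cdiff_rect_cont dg)).
  have {}P1 := P1 (fun s t ss tt => dg s t ltac:(lra) ltac:(lra)).
  have {}P2 := P2 (fun s t ss tt => dg s t ltac:(lra) ltac:(lra)).
  have {}P3 := P3 (fun s t ss tt => dg s t ltac:(lra) ltac:(lra)).
  have {}P4 := P4 (fun s t ss tt => dg s t ltac:(lra) ltac:(lra)).
  apply: le_trans (le_normcD _ _) _;
    apply: le_trans (lerD (le_normcD _ _) P4) _.
  apply: le_trans (lerD (lerD (le_normcD _ _) P3) (lexx _)) _.
  apply: le_trans (lerD (lerD (lerD P1 P2) (lexx _)) (lexx _)) _.
  by rewrite le_eqVlt; apply/orP; left; apply/eqP; field.
move=> s t sab tcd; have [phi /contP cphi Hphi] := dg _ _ sab tcd.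
have e40 : 0 < e / 4 by rewrite divr_gt0.
have [r r0 Hr] := cphi _ e40; exists (r / 2); first by rewrite divr_gt0.
move=> {sab tcd dg}a {}b {}c {}d sab tcd bar dcr dg.
have ab : a <= b by lra.
have cd : c <= d by lra.
set p := s +i* t.
have gE : g = fun z => (g p - phi p * p + phi p * z) + (phi z - phi p) * (z -
  p).
  by apply/funext => z; rewrite [LHS](Hphi z) -/p; ring.
pose h z := (phi z - phi p) * (z - p).
have hE : h = fun z => g z + (- (g p - phi p * p) + (- phi p) * z).
  by apply/funext => z; rewrite /h (Hphi z) -/p; ring.
have ch : cont_rect h a b c d.
  move=> u v uab vcd; rewrite hE; apply: contD; first exact/cdiff_cont/dg.
  apply: contD; first exact: cont_cst.
  by apply: contM; [exact: cont_cst|exact: cont_id].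
have ca : cont_rect (fun z => g p - phi p * p + phi p * z) a b c d.
  move=> u v uab vcd; apply: contD; first exact: cont_cst.
  by apply: contM; [exact: cont_cst|exact: cont_id].
rewrite gE (rect_intD ab cd ca ch) rect_int_affine // add0r.
have -> : e * (b - a + (d - c)) ^+ 2 =
    4 * (e / 4 * (b - a + (d - c))) * (b - a + (d - c)) by field.
apply: rect_int_bound => // u v uab vcd; rewrite normcM.
have zp : normc ((u +i* v) - p) <= b - a + (d - c).
  apply: le_trans (normc_le_ReIm _) _ => /=.
  by apply: lerD; rewrite ler_norml; lra.
apply: ler_pM; rewrite ?normc_ge0 //; apply/ltW/Hr.
by apply: le_lt_trans zp _; lra.
Qed.

End Goursat.

(** * Averages over circles *)

Section ComplexExponential.
Context {R : realType}.
Implicit Types (s t : R) (z w : R[i]).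

Lemma is_derive_eps (f : R -> R) x (l : R) : is_derive (x : R^o) 1 f l ->
  forall e : R, 0 < e -> exists2 d : R, 0 < d & forall h, `|h| < d ->
    `|f (x + h) - f x - l * h| <= e * `|h|.
Proof.
case=> df fl e e0; move: df => /cvg_ex[l' Hl'].
have ll' : l' = l by rewrite -fl; apply/esym/cvg_lim.
move/cvgrPdist_lt : Hl'; rewrite {}ll' => /(_ _ e0) /nbhs_ballP[d /= d0 Hd].
exists d => // h hd; have [->|h0] := eqVneq h 0.
  by rewrite addr0 subrr mulr0 subr0 normr0 mulr0.
have : ball (0 : R^o) d h by rewrite /ball /= sub0r normrN.
move=> /Hd /(_ h0) /ltW.
have -> : h *: (1 : R^o) + x = x + h by rewrite /GRing.scale /= mulr1 addrC.
move=> H1; have -> : f (x + h) - f x - l * h =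
    - (l - h^-1 *: ((f (x + h) : R^o) - f x)) * h.
  by rewrite /GRing.scale /= ; field.
by rewrite normrM normrN ler_wpM2r.
Qed.

Definition cexp z : R[i] :=
  (expR (Re z))%:C * (cos (Im z) +i* sin (Im z)).

Lemma cexpD z w : cexp (z + w) = cexp z * cexp w.
Proof.
case: z w => a b [c d]; rewrite /cexp /= expRD cosD sinD rmorphM /=.
by simpc; congr (_ +i* _); ring.
Qed.

Lemma normc_cis t : normc (cos t +i* sin t) = 1.
Proof. by rewrite /= cos2Dsin2 sqrtr1. Qed.

(** Assembled from the derivatives at 0 of the real exponential, cosine and
    sine; by cexpD this differentiability at 0 propagates to every point. *)
Lemma cexp_cdiff0 (e : R) : 0 < e -> exists2 d : R, 0 < d &
  forall h, normc h < d -> normc (cexp h - 1 - h) <= e * normc h.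
Proof.
move=> e0; have e80 : 0 < e / 8 by rewrite divr_gt0.
have [d1 d10 H1] := is_derive_eps (is_derive_expR 0) e80.
have [d2 d20 H2] := is_derive_eps (is_derive_cos 0) e80.
have [d3 d30 H3] := is_derive_eps (is_derive_sin 0) e80.
pose d4 := Num.min 1 (e / 8) / (1 + e / 8).
have d40 : 0 < d4 by rewrite divr_gt0 // ?lt_min ?ltr01 ?e80 // addr_gt0.
exists (Num.min (Num.min d1 d2) (Num.min d3 d4)).
  by rewrite !lt_min d10 d20 d30 d40.
case=> s t; rewrite !lt_min => /andP[/andP[h1 h2] /andP[h3 h4]].
have sh := normc_Re (s +i* t); have th := normc_Im (s +i* t).
rewrite /= in sh th.
have {}H1 := H1 s (le_lt_trans sh h1).
have {}H2 := H2 t (le_lt_trans th h2).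
have {}H3 := H3 t (le_lt_trans th h3).
rewrite add0r expR0 mul1r in H1.
rewrite add0r cos0 sin0 oppr0 mul0r subr0 in H2.
rewrite add0r cos0 sin0 mul1r subr0 in H3.
set N := normc _ in sh th h1 h2 h3 h4 *.
set E := expR s in H1 *.
have E1 : `|E - 1| <= Num.min 1 (e / 8).
  have : `|E - 1| <= (1 + e / 8) * `|s|.
    by have := ler_normD (E - 1 - s) s; rewrite subrK; lra.
  move=> /le_trans; apply; rewrite mulrC -ler_pdivlMr ?addr_gt0 //.
  exact: le_trans sh (ltW h4).
have [E11 E12] : `|E - 1| <= 1 /\ `|E - 1| <= e / 8.
  by move: E1; rewrite le_min => /andP[].
have -> : cexp (s +i* t) - 1 - (s +i* t) =
   E%:C * ((cos t - 1) +i* (sin t - t)) + ((E - 1 - s)%:C + (t * (E - 1)) *i).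
  by rewrite /cexp -/E; simpc; congr (_ +i* _); ring.
apply: le_trans (le_normcD _ _) _; rewrite normcM normcR.
have A1 : `|E| <= 2 by have := ler_normD (E - 1) 1; rewrite subrK normr1; lra.
have A2 : normc ((cos t - 1) +i* (sin t - t)) <= e / 8 * `|t| + e / 8 * `|t|.
  by apply: le_trans (normc_le_ReIm _) _; apply: lerD.
have A3 : normc ((E - 1 - s)%:C + (t * (E - 1)) *i) <= e / 8 * `|s| + `|t| *
  (e / 8).
  apply: le_trans (normc_le_ReIm _) _ => /=; rewrite addr0 add0r.
  by apply: lerD => //; rewrite normrM ler_wpM2l.
have N0 : 0 <= N by exact: normc_ge0.
have eN : 0 <= e * N by rewrite mulr_ge0 // ltW.
have A4 := ler_pM (normr_ge0 E) (normc_ge0 _) A1 A2.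
have B1 : e / 8 * `|t| <= e / 8 * N by rewrite ler_pM2l.
have B2 : e / 8 * `|s| <= e / 8 * N by rewrite ler_pM2l.
by lra.
Qed.

Lemma cdiff_cexp z : cdiff cexp z.
Proof.
apply: (@cdiff_eps _ _ _ (cexp z)) => e e0.
have e'0 : 0 < e / (1 + normc (cexp z))
  by rewrite divr_gt0 // ltr_wpDr ?normc_ge0.
have [d d0 Hd] := cexp_cdiff0 e'0; exists d => // w /Hd H.
have -> : cexp w - cexp z - cexp z * (w - z) =
    cexp z * (cexp (w - z) - 1 - (w - z)).
  have -> : cexp w = cexp z * cexp (w - z) by rewrite -cexpD addrC subrK.
  by ring.
rewrite normcM; apply: le_trans (ler_wpM2l (normc_ge0 _) H) _.
rewrite mulrA ler_wpM2r ?normc_ge0 // mulrA ler_pdivrMr ?ltr_wpDr ?normc_ge0 //.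
by rewrite mulrC ler_pM2l // lerDr.
Qed.

End ComplexExponential.

Section CircleAverage.
Context {R : realType}.
Implicit Types (r t : R) (f g : R[i] -> R[i]) (z w : R[i]).

Definition circ r t : R[i] := r%:C * (cos t +i* sin t).

Lemma normc_circ r t : 0 <= r -> normc (circ r t) = r.
Proof. by move=> r0; rewrite /circ normcM normc_cis normcR mulr1 ger0_norm. Qed.

Lemma rcont_circ r t : rcont (circ r) t.
Proof.
apply: rcontM; first exact: rcont_cst.
by apply: rcont_ReIm; [exact: continuous_cos|exact: continuous_sin].
Qed.

Lemma cexp_circ r t : 0 < r -> cexp (ln r +i* t) = circ r t.
Proof. by move=> r0; rewrite /cexp /= lnK. Qed.

Definition cont_circle r f := forall w, normc w = r -> cont f w.

Definition cavg r f : R[i] :=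
  ((pi *+ 2)^-1)%:C * cint 0 (pi *+ 2) (fun t => f (circ r t)).

Lemma tau_gt0 : 0 < pi *+ 2 :> R.
Proof. by rewrite mulrn_wgt0 // pi_gt0. Qed.

Lemma cont_itv_circ r f a b : 0 <= r -> cont_circle r f ->
  cont_itv a b (fun t => f (circ r t)).
Proof.
move=> r0 cf t _; apply: rcont_comp; first exact: rcont_circ.
exact/cf/normc_circ.
Qed.

Lemma eq_cavg r f g : 0 <= r -> (forall w, normc w = r -> f w = g w) ->
  cavg r f = cavg r g.
Proof.
by move=> r0 fg; congr (_ * _); apply: eq_cint => t _; rewrite fg // normc_circ.
Qed.

Lemma cavgD r f g : 0 <= r -> cont_circle r f -> cont_circle r g ->
  cavg r (fun w => f w + g w) = cavg r f + cavg r g.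
Proof.
by move=> r0 cf cg; rewrite /cavg cintD;
  [rewrite mulrDr|exact: cont_itv_circ..].
Qed.

Lemma cavgZ r (c : R[i]) f : 0 <= r -> cont_circle r f ->
  cavg r (fun w => c * f w) = c * cavg r f.
Proof.
by move=> r0 cf; rewrite /cavg cintZ; [rewrite mulrCA|exact: cont_itv_circ].
Qed.

Lemma cavg_cst r (c : R[i]) : cavg r (fun=> c) = c.
Proof.
rewrite /cavg cint_cst; last by rewrite ltW // tau_gt0.
by rewrite subr0 mulrCA -rmorphM /= mulVf ?gt_eqF ?tau_gt0 // mulr1.
Qed.

Lemma cavg_bound r f M : 0 <= r -> cont_circle r f ->
  (forall w, normc w = r -> normc (f w) <= M) -> normc (cavg r f) <= 2 * M.
Proof.
move=> r0 cf fM; rewrite /cavg normcM normcR ger0_norm; last first.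
  by rewrite invr_ge0 ltW // tau_gt0.
rewrite mulrC ler_pdivrMr ?tau_gt0 //.
have := cint_bound (ltW tau_gt0) (cont_itv_circ (a := 0) (b := pi *+ 2) r0 cf)
  (fun t _ => fM _ (normc_circ t r0)).
by rewrite subr0.
Qed.

(** In logarithmic coordinates the annulus becomes a rectangle. By periodicity
    the integrals over its horizontal sides are equal, so Goursat's theorem
    equates the integrals over the vertical sides, which are the two
    circles. *)
Lemma cavg_annulus r1 r2 f : 0 < r1 -> r1 <= r2 ->
  (forall w, r1 <= normc w <= r2 -> cdiff f w) -> cavg r1 f = cavg r2 f.
Proof.
move=> r10 r12 df; have r20 : 0 < r2 by exact: lt_le_trans r12.
have l12 : ln r1 <= ln r2 by rewrite ler_ln.
have dg : cdiff_rect (fun z => f (cexp z)) (ln r1) (ln r2) 0 (pi *+ 2).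
  move=> s t /andP[s1 s2] _; apply: cdiff_comp; first exact: cdiff_cexp.
  apply: df; rewrite /cexp normcM normc_cis mulr1 normcR /= ger0_norm
    ?expR_ge0 //.
  move: s1 s2; rewrite -ler_expR lnK // => ->.
  by rewrite -ler_expR lnK.
have := goursat l12 (ltW tau_gt0) dg.
rewrite /rect_int -(@eq_cint _ (fun s => f (cexp (s +i* 0)))); last first.
  by move=> s _; rewrite /cexp /= cos2pi sin2pi cos0 sin0.
rewrite subrr add0r => /eqP; rewrite mulf_eq0 => /orP[/eqP[]|].
  by move=> /eqP; rewrite oner_eq0.
rewrite subr_eq0 => /eqP H; rewrite /cavg; congr (_ * _).
rewrite (@eq_cint _ _ (fun t => f (cexp (ln r1 +i* t)))).
  by rewrite -H; apply: eq_cint => t _; rewrite cexp_circ.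
by move=> t _; rewrite cexp_circ.
Qed.

(** Compactness of the interval of angles makes the continuity of f along the
    circle uniform. *)
Lemma cavg_near r0 f (e : R) : 0 <= r0 -> 0 < e -> cont_circle r0 f ->
  exists2 d : R, 0 < d & forall r, 0 <= r -> `|r - r0| < d -> cont_circle r f ->
    normc (cavg r f - cavg r0 f) <= e.
Proof.
move=> r00 e0 cf.
have /compact_near_coveringP cpt : compact `[(0 : R), pi *+ 2]
  by exact: segment_compact.
have e20 : 0 < e / 2 by rewrite divr_gt0.
have e40 : 0 < e / 4 by rewrite divr_gt0.
have := cpt _ (nbhs r0) (fun r t =>
  normc (f (circ r t) - f (circ r0 t)) <= e / 2) _.
case=> [t _|d d0 Hd].
  have /contP/(_ _ e40)[d d0 Hd] := cf _ (normc_circ t r00).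
  have d20 : 0 < d / 2 by rewrite divr_gt0.
  have [/cvgrPdist_lt/(_ (d / 2)%:C)] := rcont_circ r0 t.
  rewrite ltcR => /(_ d20) near_t.
  have near_r : \forall r \near r0, `|r0 - r| < d / 2.
    by apply: (@cvgr_dist_lt _ R^o _ (nbhs r0) _ id) => // A.
  near=> t' r => /=.
  have t'd : normc (circ r0 t' - circ r0 t) < d / 2.
    rewrite normcB -ltcR -norm_normc.
    by near: t'; exact: near_t.
  have rd : normc (circ r t' - circ r0 t') < d / 2.
    rewrite /circ -mulrBl -rmorphB normcM normc_cis mulr1 normcR distrC.
    by near: r; exact: near_r.
  have h1 : normc (f (circ r0 t') - f (circ r0 t)) < e / 4 by apply: Hd; lra.
  have h2 : normc (f (circ r t') - f (circ r0 t)) < e / 4.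
    apply: Hd; have := le_normcD (circ r t' - circ r0 t') (circ r0 t' - circ
      r0 t).
    by rewrite addrA subrK; lra.
  have := le_normcD (f (circ r t') - f (circ r0 t)) (f (circ r0 t) - f (circ
    r0 t')).
  by rewrite addrA subrK normcB in h1 *; lra.
exists d => // r r0' rd cfr.
have {}Hd t : 0 <= t <= pi *+ 2 ->
  normc (f (circ r t) - f (circ r0 t)) <= e / 2.
  by move=> tt; apply: Hd; rewrite /= ?in_itv //= distrC.
rewrite /cavg -mulrBr normcM normcR ger0_norm; last first.
  by rewrite invr_ge0 ltW // tau_gt0.
rewrite mulrC ler_pdivrMr ?tau_gt0 //.
have c1 := cont_itv_circ (a := 0) (b := pi *+ 2) r0' cfr.
have c0 := cont_itv_circ (a := 0) (b := pi *+ 2) r00 cf.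
have cN : cont_itv 0 (pi *+ 2) (fun t => -1 * f (circ r0 t)).
  by move=> t tt; apply: rcontM; [exact: rcont_cst|exact: c0].
rewrite -mulN1r -cintZ // -cintD //.
have cD : cont_itv 0 (pi *+ 2) (fun t => f (circ r t) + -1 * f (circ r0 t)).
  by move=> t tt; apply: rcontD; [exact: c1|exact: cN].
have -> : e * (pi *+ 2) = 2 * (e / 2) * (pi *+ 2 - 0) by field.
apply: (cint_bound (ltW tau_gt0) cD) => t tt.
by rewrite mulN1r; exact: Hd.
Unshelve. all: by end_near. Qed.

End CircleAverage.

(** * Cauchy's formula *)

Section CauchyFormula.
Context {R : realType}.
Implicit Types (r rho M : R) (f h : R[i] -> R[i]) (z w : R[i]).

Definition cont_disc rho f := forall w, normc w < rho -> cont f w.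

Lemma cont_disc_circle rho r f : r < rho -> cont_disc rho f -> cont_circle r f.
Proof. by move=> rr cf w wr; apply: cf; rewrite wr. Qed.

(** The average of f is independent of the radius as long as the circles do
    not sweep across z. Being continuous in the radius, it does not jump at
    the circle through z, and it tends to f 0 for small radii. Hence
    continuity suffices at 0 and on that circle. *)
Lemma mean_value rho f z r : cont_disc rho f ->
  (forall w, normc w < rho -> w != 0 -> normc w != normc z -> cdiff f w) ->
  0 < r < rho -> cavg r f = f 0.
Proof.
move=> cf df /andP[r0 rr].
have annulus r1 r2 : 0 < r1 -> r1 <= r2 -> r2 < rho ->
    (normc z < r1 \/ r2 < normc z) -> cavg r1 f = cavg r2 f.
  move=> r10 r12 r2r Hz; apply: cavg_annulus => // w /andP[w1 w2]; apply: df.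
  - exact: le_lt_trans r2r.
  - by rewrite -normc_gt0; exact: lt_le_trans w1.
  - by case: Hz => Hz; rewrite ?(gt_eqF (lt_le_trans Hz w1)) // lt_eqF //
    (le_lt_trans w2).
have eqe (x y : R[i]) : (forall e : R, 0 < e -> normc (x - y) <= e) -> x = y.
  move=> H; apply/eqP; rewrite -subr_eq0 -normc_eq0 eq_le normc_ge0 andbT.
  by apply/ler_addgt0Pr => e e0; rewrite add0r; exact: H.
have const r1 r2 : 0 < r1 -> r1 <= r2 -> r2 < rho -> cavg r1 f = cavg r2 f.
  move=> r10 r12 r2r.
  have [z1|z1] := ltP (normc z) r1; first by apply: annulus => //; left.
  have [z2|z2] := ltP r2 (normc z); first by apply: annulus => //; right.
  have z0 : 0 < normc z by exact: lt_le_trans z1.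
  have zr : normc z < rho by exact: le_lt_trans r2r.
  have near e (e0 : 0 < e) := cavg_near (normc_ge0 z) e0 (cont_disc_circle zr
    cf).
  (* The averages on both sides agree with the one over the circle through
     z. *)
  transitivity (cavg (normc z) f); apply: eqe => e e0.
    have [d d0 Hd] := near _ e0.
    have [->|r1z] := eqVneq r1 (normc z); first by rewrite subrr normc0 ltW.
    have {}r1z : r1 < normc z by rewrite lt_neqAle r1z.
    have [s [s1 s2 s3]] : exists s :
      R, [/\ r1 <= s, normc z - d / 2 <= s & s < normc z].
      exists (Num.max r1 (normc z - d / 2)).
      by split; rewrite ?le_max ?lexx ?orbT // gt_max r1z; lra.
    rewrite (@annulus r1 s) //; [|exact: lt_trans zr|by right].
    apply: Hd; [by lra|by rewrite ltr_norml; lra|].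
    by apply: cont_disc_circle cf; lra.
  have [d d0 Hd] := near _ e0.
  have [->|r2z] := eqVneq r2 (normc z); first by rewrite subrr normc0 ltW.
  have {}r2z : normc z < r2 by rewrite lt_neqAle eq_sym r2z.
  have [s [s1 s2 s3]] : exists s :
    R, [/\ s <= r2, s <= normc z + d / 2 & normc z < s].
    exists (Num.min r2 (normc z + d / 2)).
    by split; rewrite ?ge_min ?lexx ?orbT // lt_min r2z; lra.
  rewrite -(@annulus s r2) //; [|by lra|by left].
  rewrite normcB; apply: Hd; [by lra|by rewrite ltr_norml; lra|].
  by apply: cont_disc_circle cf; lra.
apply: eqe => e e0; have rho0 : 0 < rho by exact: lt_trans rr.
have /contP : cont f 0 by apply: cf; rewrite normc0.
have e20 : 0 < e / 2 by rewrite divr_gt0.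
move=> /(_ _ e20)[d d0 Hd];
  have [s [s1 s2 s0]] : exists s : R, [/\ s <= r, s <= d / 2 & 0 < s].
  exists (Num.min r (d / 2)).
  by split; rewrite ?ge_min ?lexx ?orbT // lt_min r0; lra.
have cs : cont_circle s f by apply: cont_disc_circle cf; lra.
have s0' := ltW s0; rewrite -(const s r) // -(cavg_cst s (f 0)) -mulN1r -cavgZ
  //; last first.
  by move=> w _; exact: cont_cst.
rewrite -cavgD //; last by move=> w _; apply: contM; exact: cont_cst.
have -> : e = 2 * (e / 2) by field.
apply: cavg_bound; first exact: ltW.
  by move=> w ws; apply: contD; [exact: cs|apply: contM; exact: cont_cst].
move=> w ws; rewrite mulN1r; apply/ltW/Hd; rewrite subr0 ws.
by lra.
Qed.

Lemma cont_kernel z w : w != z -> cont (fun w => w / (w - z)) w.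
Proof.
move=> wz; apply: contM; first exact: cont_id.
apply: contV; first by rewrite subr_eq0.
by apply: contB; [exact: cont_id|exact: cont_cst].
Qed.

(** The kernel is 1 + z / (w - z), and the average of z / (w - z) is
    independent of the radius while it tends to 0 for large radii. *)
Lemma cavg_kernel z r : normc z < r -> cavg r (fun w => w / (w - z)) = 1.
Proof.
move=> zr; have r0 : 0 < r by exact: le_lt_trans (normc_ge0 _) zr.
have nwz w s : normc z < s -> normc w = s -> w != z.
  by move=> zs ws; apply: contraTneq zs => <-; rewrite ws ltxx.
have cq s : normc z < s -> cont_circle s (fun w => z / (w - z)).
  move=> zs w ws; apply: contM; first exact: cont_cst.
  apply: contV; first by rewrite subr_eq0 (nwz w s).
  by apply: contB; [exact: cont_id|exact: cont_cst].
rewrite (@eq_cavg _ _ _ (fun w => 1 + z / (w - z))) ?ltW //; last first.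
  move=> w wr; have := nwz _ _ zr wr; rewrite -subr_eq0 => wz.
  by field.
rewrite cavgD ?ltW //; [|by move=> w _; exact: cont_cst|exact: cq].
rewrite cavg_cst [X in _ + X](_ : _ = 0) ?addr0 //.
apply/eqP; rewrite -normc_eq0 eq_le normc_ge0 andbT.
apply/ler_addgt0Pr => e e0; rewrite add0r.
have [s sE] : exists s : R, s = r + 2 * normc z / e
  by exists (r + 2 * normc z / e).
have z0 := normc_ge0 z.
have q0 : 0 <= 2 * normc z / e by rewrite divr_ge0 ?mulr_ge0 // ltW.
have rs : r <= s by rewrite sE lerDl.
have zs : normc z < s by exact: lt_le_trans rs.
rewrite (@cavg_annulus _ r s) //; last first.
  move=> w /andP[rw _]; apply: cdiffM; first exact: cdiff_cst.
  apply: cdiffV; last by apply: cdiffB; [exact: cdiff_id|exact: cdiff_cst].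
  by rewrite subr_eq0; apply: contraTneq rw => ->; rewrite -ltNge.
have -> : e = 2 * (e / 2) by field.
apply: cavg_bound; [by lra|exact: cq|].
move=> w ws; have wz := nwz _ _ zs ws.
rewrite normcM normcV ler_pdivrMr ?normc_gt0 ?subr_eq0 //.
have := ler_normcB w z; rewrite ws => H.
have : e / 2 * (2 * normc z / e) <= e / 2 * normc (w - z).
  by rewrite ler_pM2l ?divr_gt0 //; lra.
suff -> : e / 2 * (2 * normc z / e) = normc z by [].
by field; rewrite gt_eqF.
Qed.

(** The slope of h at z, multiplied by w, is continuous and vanishes at w = 0,
    so its average is 0 by the mean value property. At 0 the function h is
    only continuous: the formula is applied below to quotients by powers of
    the variable. *)
Lemma cauchy_formula rho h z r : cont_disc rho h ->
  (forall w, normc w < rho -> w != 0 -> cdiff h w) ->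
  normc z < r -> r < rho ->
  cavg r (fun w => h w * (w / (w - z))) = h z.
Proof.
move=> ch dh zr rr; have r0 : 0 < r by exact: le_lt_trans (normc_ge0 _) zr.
have zrho : normc z < rho by exact: lt_trans rr.
have r0r : 0 < r < rho by rewrite r0.
have nwz w : normc w = r -> w != z.
  by move=> wr; apply: contraTneq zr => <-; rewrite wr ltxx.
have [z0|z0] := eqVneq z 0.
  rewrite z0 -(@mean_value rho h 0 r) // => [|w wr w0 _]; last exact: dh.
  apply: eq_cavg; first exact: ltW.
  move=> w wr; rewrite subr0 divff ?mulr1 //.
  by rewrite -normc_gt0 wr.
have [phi cphi Hphi] := dh _ zrho z0.
pose Phi w := phi w * w.
have phiE w : w != z -> phi w = (h w - h z) / (w - z).
  by move=> wz; rewrite (Hphi w) addrC addKr mulfK // subr_eq0.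
have near_ne w : w != z -> forall v, normc (v - w) < normc (w - z) -> v != z.
  by move=> wz v; apply: contraTneq => ->; rewrite normcB ltxx.
have cPhi : cont_disc rho Phi.
  move=> w wr; apply: contM; last exact: cont_id.
  have [->//|wz] := eqVneq w z.
  have wz0 : 0 < normc (w - z) by rewrite normc_gt0 subr_eq0.
  apply: (cont_near (f := fun w => (h w - h z) / (w - z)) wz0).
    by move=> v vw; rewrite phiE // (near_ne _ wz).
  apply: contM; first by apply: contB; [exact: ch|exact: cont_cst].
  apply: contV; first by rewrite subr_eq0.
  by apply: contB; [exact: cont_id|exact: cont_cst].
have dPhi w : normc w < rho -> w != 0 -> normc w != normc z -> cdiff Phi w.
  move=> wr w0 wz; apply: cdiffM; last exact: cdiff_id.
  have {}wz : w != z by apply: contraNneq wz => ->.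
  have wz0 : 0 < normc (w - z) by rewrite normc_gt0 subr_eq0.
  apply: (cdiff_near (f := fun w => (h w - h z) / (w - z)) wz0).
    by move=> v vw; rewrite phiE // (near_ne _ wz).
  apply: cdiffM; first by apply: cdiffB; [exact: dh|exact: cdiff_cst].
  apply: cdiffV; first by rewrite subr_eq0.
  by apply: cdiffB; [exact: cdiff_id|exact: cdiff_cst].
have ck : cont_circle r (fun w => w / (w - z)).
  by move=> w wr; apply: cont_kernel; exact: nwz.
have := mean_value cPhi dPhi r0r; rewrite {2}/Phi mulr0 => H.
apply/eqP; rewrite -subr_eq0; apply/eqP; rewrite -[RHS]H.
rewrite (@eq_cavg _ _ Phi (fun w =>
  h w * (w / (w - z)) + - h z * (w / (w - z)))).
- rewrite cavgD ?cavgZ ?cavg_kernel ?mulr1 //; first exact: ltW.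
  + exact: ltW.
  + by move=> w wr; apply: contM; [apply: ch; rewrite wr|exact: ck].
  + by move=> w wr; apply: contM; [exact: cont_cst|exact: ck].
- exact: ltW.
move=> w wr; have wz := nwz _ wr; rewrite /Phi phiE //.
by move: wz; rewrite -subr_eq0 => wz; field.
Qed.

Lemma cauchy_estimate rho h z r M : cont_disc rho h ->
  (forall w, normc w < rho -> w != 0 -> cdiff h w) ->
  normc z < r -> r < rho -> (forall w, normc w = r -> normc (h w) <= M) ->
  normc (h z) <= 2 * (M * (r / (r - normc z))).
Proof.
move=> ch dh zr rr hM; rewrite -(cauchy_formula ch dh zr rr).
have r0 : 0 < r by exact: le_lt_trans (normc_ge0 _) zr.
have nwz w : normc w = r -> w != z.
  by move=> wr; apply: contraTneq zr => <-; rewrite wr ltxx.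
apply: cavg_bound; first exact: ltW.
  move=> w wr; apply: contM; first by apply: ch; rewrite wr.
  by apply: cont_kernel; exact: nwz.
move=> w wr; rewrite !normcM normcV wr.
have r0' := ltW r0; apply: ler_pM; rewrite ?normc_ge0 ?hM //.
  by rewrite mulr_ge0 ?invr_ge0 ?normc_ge0.
rewrite ler_pM2l // lef_pV2 ?posrE ?normc_gt0 ?subr_eq0 ?nwz ?subr_gt0 //.
by rewrite -wr; exact: ler_normcB.
Qed.

(** Expanding the kernel w / (w - z) as a finite geometric sum in Cauchy's
    formula produces the coefficients c l and the explicit remainder
    z ^ L * T L z. *)
Lemma taylor_bound rho h M (L : nat) : 0 < rho ->
  (forall w, normc w < rho -> cdiff h w) ->
  (forall w, normc w < rho -> normc (h w) <= M) ->
  exists q : {poly R[i]}, exists2 d : R, 0 < d & exists2 K : R, 0 <= K &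
    forall z, normc z < d -> normc (h z - q.[z]) <= K * normc z ^+ L.
Proof.
move=> rho0 dh hM; have [r r0 rr] : exists2 r, 0 < r & r < rho
  by exists (rho / 2); lra.
have ch : cont_disc rho h by move=> w wr; apply/cdiff_cont/dh.
have chr : cont_circle r h by exact: cont_disc_circle rr ch.
have w0 w : normc w = r -> w != 0 by move=> wr; rewrite -normc_gt0 wr.
have cV (l : nat) : cont_circle r (fun w => (w ^+ l)^-1).
  move=> w wr; apply: contV; first by rewrite expf_neq0 // w0.
  by apply: cdiff_cont; apply: cdiffX; exact: cdiff_id.
pose c l := cavg r (fun w => h w * (w ^+ l)^-1).
pose T l z := cavg r (fun w => h w * (w ^+ l)^-1 * (w / (w - z))).
have nwz z w : normc z < r -> normc w = r -> w != z.
  by move=> zr wr; apply: contraTneq zr => <-; rewrite wr ltxx.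
have cT l z : normc z < r ->
  cont_circle r (fun w => h w * (w ^+ l)^-1 * (w / (w - z))).
  move=> zr w wr; apply: contM; last by apply: cont_kernel; exact: nwz wr.
  by apply: contM; [exact: chr|exact: cV].
have Trec l z : normc z < r -> T l z = c l + z * T l.+1 z.
  move=> zr; rewrite /T /c -cavgZ ?ltW //; last exact: cT.
  rewrite -cavgD ?ltW //; last 2 first.
  - by move=> w wr; apply: contM; [exact: chr|exact: cV].
  - by move=> w wr; apply: contM; [exact: cont_cst|exact: cT].
  apply: eq_cavg; first exact: ltW.
  move=> w wr; have := nwz _ _ zr wr; rewrite -subr_eq0 => wz.
  have wn := w0 _ wr; have wl : w ^+ l != 0 by rewrite expf_neq0.
  by rewrite exprS; field; rewrite wn wl wz.
have hT z : normc z < r -> h z = \sum_(l < L) c l * z ^+ l + z ^+ L * T L z.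
  move=> zr; elim: L => [|l IH].
    rewrite big_ord0 add0r mul1r -(cauchy_formula ch _ zr rr) //.
      by apply: eq_cavg => [|w _]; [exact: ltW|rewrite invr1 mulr1].
    by move=> w wr _; exact: dh.
  by rewrite big_ord_recr /= IH Trec // exprS; ring.
exists (\poly_(l < L) c l), (r / 2); first by rewrite divr_gt0.
have M0 : 0 <= M by apply: le_trans (hM 0 _); rewrite ?normc_ge0 ?normc0.
exists (2 * (M * (r ^+ L)^-1 * 2)).
  by rewrite !mulr_ge0 // invr_ge0 exprn_ge0 // ltW.
move=> z zr; have zr' : normc z < r by lra.
rewrite horner_poly hT // addrC addKr normcM normcX (mulrC (normc z ^+ L)).
apply: ler_wpM2r; first by rewrite exprn_ge0 // normc_ge0.
apply: cavg_bound; [exact: ltW|exact: cT|move=> w wr].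
rewrite !normcM !normcV normcX wr; have wz := ler_normcB w z.
have r0' := ltW r0; have rL := exprn_ge0 L r0'.
apply: ler_pM; rewrite ?mulr_ge0 ?invr_ge0 ?normc_ge0 //.
  by rewrite ler_pM2r ?invr_gt0 ?exprn_gt0 // hM // wr.
rewrite ler_pdivrMr; first by lra.
by rewrite wr in wz; lra.
Qed.

End CauchyFormula.

(** * Polynomials and power sums *)

Section PolynomialAlgebra.
Context {R : realType}.
Implicit Types (p q : {poly R[i]}) (s r : seq R[i]) (a x : R[i]).

(** The Chinese remainder theorem for the coprime moduli (X - a) ^ L: the
    algebra of Hermite interpolation. *)
Lemma poly_crt (L : nat) s (q : R[i] -> {poly R[i]}) : uniq s ->
  exists Q : {poly R[i]}, forall a, a \in s -> ('X - a%:P) ^+ L %| Q - q a.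
Proof.
elim: s => [|b s IH] /=; first by exists 0.
move=> /andP[bs us]; have [Q HQ] := IH us.
pose P := \prod_(a <- s) ('X - a%:P) ^+ L.
have cop : coprimep P (('X - b%:P) ^+ L).
  rewrite coprimep_sym /P big_seq.
  elim/big_ind: _ => [|u v cu cv|a as_]; first exact: coprimep1.
    by rewrite coprimepMr cu.
  apply: coprimep_expl; apply: coprimep_expr.
  by rewrite coprimep_XsubC2 // subr_eq0; apply: contraNneq bs => <-.
have [[u v] /= huv] := Bezout_eq1_coprimepP _ _ cop.
exists (Q + u * P * (q b - Q)) => a; rewrite inE => /predU1P[->|as_].
  have -> : Q + u * P * (q b - Q) - q b = - (v * (q b - Q)) * ('X - b%:P) ^+ L.
    by rewrite -[u * P](addrK (v * ('X - b%:P) ^+ L)) huv; ring.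
  exact: dvdp_mull.
have -> : Q + u * P * (q b - Q) - q a = (Q - q a) + u * (q b - Q) * P by ring.
apply: dvdp_add; first exact: HQ.
apply: dvdp_mull; rewrite /P (big_rem a) //=; exact: dvdp_mulr.
Qed.

Lemma prod_mup p s : uniq s -> p \is monic -> (forall x, root p x -> x \in s) ->
  p = \prod_(a <- s) ('X - a%:P) ^+ mup a p.
Proof.
move=> us mp ps; have [r] := closed_field_poly_normal p.
rewrite (monicP mp) scale1r => pE.
have rs : {subset r <= s} by move=> x xr; apply: ps; rewrite pE root_prod_XsubC.
transitivity (\prod_(a <- s) ('X - a%:P) ^+ count_mem a r); last first.
  by apply: eq_bigr => a _; rewrite pE mu_prod_XsubC.
rewrite pE; clear -us rs; elim: r rs => [|x r IH] rs.
  by rewrite big_nil big1 // => a _; rewrite expr0.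
rewrite big_cons IH; last by move=> y yr; apply: rs; rewrite inE yr orbT.
have xs : x \in s by apply: rs; rewrite inE eqxx.
rewrite (bigD1_seq x) //= [RHS](bigD1_seq x) //= eqxx add1n exprS mulrA.
congr (_ * _); apply: eq_bigr => a ax.
by rewrite eq_sym (negbTE ax) add0n.
Qed.

(** The root a nearest to x works, since every factor is at least |x - a|. *)
Lemma horner_prod_XsubC_min r x : (0 < size r)%N ->
  exists2 a, a \in r &
    normc (x - a) ^+ size r <= normc (\prod_(b <- r) ('X - b%:P)).[x].
Proof.
move=> r0; have [a ar amin] : exists2 a, a \in r &
    forall b, b \in r -> normc (x - a) <= normc (x - b).
  elim: r r0 => // a [_|b r IH] _.
    by exists a; rewrite ?mem_head // => b; rewrite inE => /eqP->.
  have [c cr cmin] := IH isT;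
    have [ac|/ltW ca] := leP (normc (x - a)) (normc (x - c)).
    exists a; rewrite ?mem_head // => d; rewrite inE => /predU1P[->//|/cmin].
    exact: le_trans.
  exists c; first by rewrite inE cr orbT.
  by move=> d; rewrite inE => /predU1P[->//|/cmin].
exists a => //; rewrite horner_prod normc_prod.
have -> : normc (x - a) ^+ size r = \prod_(b <- r) normc (x - a).
  by rewrite big_const_seq count_predT iter_mulr_1.
rewrite !big_seq; apply: ler_prod => b br.
by rewrite normc_ge0 !hornerE amin.
Qed.

(** A polynomial P that vanishes at all entries other than b isolates b: the
    sum of P(x) x ^ (k + 1) over the entries is a fixed combination of power
    sums, hence O(rho ^ k), and it is a fixed nonzero multiple of
    b ^ (k + 1). *)
Lemma power_sum_bound r (C rho : R) b : 0 <= rho ->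
  (forall k : nat, normc (\sum_(x <- r) x ^+ k.+1) <= C * rho ^+ k) ->
  b \in r -> normc b <= rho.
Proof.
move=> rho0 HC br; rewrite leNgt; apply/negP => rb.
pose P := \prod_(a <- undup r | a != b) ('X - a%:P).
have Pb : P.[b] != 0.
  rewrite /P horner_prod prodf_seq_neq0; apply/allP => a _; apply/implyP => ab.
  by rewrite !hornerE subr_eq0 eq_sym.
have Pa x : x \in r -> x != b -> P.[x] = 0.
  move=> xr xb; rewrite /P -big_filter; apply/eqP.
  change (root (\prod_(a <- [seq a <- undup r | a != b]) ('X - a%:P)) x).
  by rewrite root_prod_XsubC mem_filter xb mem_undup.
have E (k : nat) : \sum_(x <- r) P.[x] * x ^+ k.+1 = (count_mem b r)%:R *
  P.[b] * b ^+ k.+1.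
  have -> : \sum_(x <- r) P.[x] * x ^+ k.+1 = \sum_(x <- r | x == b) P.[b] * b
    ^+ k.+1.
    rewrite [RHS]big_mkcond /= !big_seq; apply: eq_bigr => x xr.
    by case: eqVneq => [->//|xb]; rewrite Pa // mul0r.
  by rewrite big_const_seq iter_addr_0 -mulrA mulr_natl.
pose K := \sum_(l < size P) normc P`_l * (C * rho ^+ l).
have HK (k : nat) : normc (\sum_(x <- r) P.[x] * x ^+ k.+1) <= K * rho ^+ k.
  have -> : \sum_(x <- r) P.[x] * x ^+ k.+1 =
      \sum_(l < size P) P`_l * \sum_(x <- r) x ^+ (k + l).+1.
    under [RHS]eq_bigr do rewrite big_distrr /=.
    rewrite exchange_big /=; apply: eq_bigr => x _.
    rewrite horner_coef big_distrl /=; apply: eq_bigr => l _.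
    by rewrite -mulrA -exprD addnS addnC.
  apply: le_trans (normc_sum _ _ _) _; rewrite /K big_distrl /=.
  apply: ler_sum => l _; rewrite normcM -mulrA ler_wpM2l ?normc_ge0 //.
  by rewrite -mulrA -exprD addnC; exact: HC.
have b0 : 0 < normc b by exact: le_lt_trans rb.
pose c := (count_mem b r)%:R * normc P.[b] * normc b.
have c0 : 0 < c.
  rewrite !mulr_gt0 // ?normc_gt0 // ltr0n -has_count.
  by apply/hasP; exists b => //=.
have Hq (k : nat) : c <= K * (rho / normc b) ^+ k.
  rewrite expr_div_n mulrA ler_pdivlMr ?exprn_gt0 //.
  have := HK k; rewrite E !normcM normcX exprS mulrA -normcM.
  have -> : normc ((count_mem b r)%:R * P.[b]) = (count_mem b r)%:R * normc
    P.[b].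
    rewrite normcM; congr (_ * _).
    have -> : (count_mem b r)%:R = ((count_mem b r)%:R : R)%:C :> R[i].
      by rewrite rmorph_nat.
    by rewrite normcR ger0_norm.
  by [].
have q1 : `|rho / normc b| < 1.
  by rewrite ger0_norm ?divr_ge0 ?normc_ge0 // ltr_pdivrMr // mul1r.
have e0 : 0 < c / (1 + `|K|) by rewrite divr_gt0 // ltr_wpDr.
have /cvgrPdist_lt/(_ _ e0)[n _ /(_ n (leqnn n))] := cvg_expr q1.
rewrite sub0r normrN ltr_pdivlMr ?ltr_wpDr // => H.
have h1 := ler_norm (K * (rho / normc b) ^+ n).
have h2 : `|K * (rho / normc b) ^+ n| <= `|(rho / normc b) ^+ n| * (1 + `|K|).
  by rewrite normrM mulrC ler_wpM2l // lerDr.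
by have := Hq n; lra.
Qed.

End PolynomialAlgebra.

(** * Spectra of matrices *)

Section MatrixSpectrum.
Context {R : realType}.
Context {n : nat}.
Implicit Types (A B : 'M[R[i]]_n.+1) (q : {poly R[i]}) (a x : R[i]).

(** The eigenvalues repeated according to their algebraic multiplicities. *)
Definition spec A : seq R[i] := sval (closed_field_poly_normal (char_poly A)).

Lemma spec_prod A : char_poly A = \prod_(x <- spec A) ('X - x%:P).
Proof.
rewrite /spec; case: closed_field_poly_normal => r /= {1}->.
by rewrite (monicP (char_poly_monic A)) scale1r.
Qed.

Lemma mem_spec A x : (x \in spec A) = eigenvalue A x.
Proof. by rewrite eigenvalue_root_char spec_prod root_prod_XsubC. Qed.

Lemma size_spec A : size (spec A) = n.+1.
Proof.
apply: succn_inj; rewrite -(size_prod_XsubC _ id) -spec_prod.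
exact: size_char_poly.
Qed.

Lemma char_poly_similar (P A B : 'M[R[i]]_n.+1) : P \in unitmx ->
  P *m A = B *m P -> char_poly A = char_poly B.
Proof.
move=> Pu PAB; pose P' := map_mx polyC P.
have dP : \det P' != 0 by rewrite det_map_mx polyC_eq0 -unitfE -unitmxE.
apply: (mulfI dP); rewrite [in RHS]mulrC -!det_mulmx; congr (\det _).
rewrite /char_poly_mx mulmxBr mulmxBl -!map_mxM PAB; congr (_ - _).
by rewrite scalar_mxC.
Qed.

Lemma horner_mx_trig (T : 'M[R[i]]_n.+1) q : is_trig_mx T ->
  is_trig_mx (horner_mx T q) /\ forall i, horner_mx T q i i = q.[T i i].
Proof.
move=> /is_trig_mxP Tt; elim/poly_ind: q => [|q c [/is_trig_mxP IH1 IH2]].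
  rewrite rmorph0; split; first exact: mx0_is_trig.
  by move=> i; rewrite mxE horner0.
rewrite rmorphD rmorphM /= horner_mx_X horner_mx_C; split.
  apply/is_trig_mxP => i j ij; rewrite !mxE big1 ?add0r.
    by rewrite -val_eqE ltn_eqF.
  move=> k _; have [ik|ki] := ltnP i k; first by rewrite IH1 // mul0r.
  by rewrite Tt ?mulr0 //; exact: leq_ltn_trans ij.
move=> i; rewrite !mxE eqxx (bigD1 i) //= big1 ?addr0 => [|k ki].
  by rewrite IH2 !hornerE.
move: ki; rewrite neq_ltn => /orP[ki|ik]; last by rewrite IH1 // mul0r.
by rewrite Tt // mulr0.
Qed.

(** By Schur's theorem A is similar to a triangular matrix; polynomials act on
    its diagonal entrywise, and that diagonal is a rearrangement of the roots
    of the characteristic polynomial. *)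
Lemma trace_horner_mx A q : \tr (horner_mx A q) = \sum_(x <- spec A) q.[x].
Proof.
have [//|P /unitarymx_unit Pu] := @Schur _ n.+1 A.
set T := conjmx P A => Tt.
have PA : P *m A = T *m P.
  by rewrite /T conjumx // mulmxKV.
have AE : A = invmx P *m T *m P by rewrite -mulmxA -PA mulmxA mulVmx // mul1mx.
rewrite {1}AE horner_mx_uconjC // mxtrace_mulC mulmxA mulmxV // mul1mx.
have [_ Hd] := horner_mx_trig q Tt.
have : perm_eq (spec A) [seq T i i | i <- enum 'I_n.+1].
  apply: prod_XsubC_eq; rewrite -spec_prod (char_poly_similar Pu PA).
  by rewrite char_poly_trig // big_map big_enum.
move=> /(perm_big _) ->; rewrite big_map big_enum.
by apply: eq_bigr => i _; rewrite Hd.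
Qed.

Lemma eigenvector_horner A (v : 'rV_n.+1) a q : v *m A = a *: v ->
  v *m horner_mx A q = q.[a] *: v.
Proof.
move=> vA; elim/poly_ind: q => [|q c IH].
  by rewrite rmorph0 mulmx0 horner0 scale0r.
rewrite rmorphD rmorphM /= horner_mx_X horner_mx_C mulmxDr mulmxA IH.
by rewrite -scalemxAl vA scalerA !hornerE scalerDl mul_mx_scalar.
Qed.

(** An eigenvector of A for a is an eigenvector of q(A) for q(a); compare its
    largest coordinate with the same coordinate of its image. *)
Lemma horner_eigenvalue_bound A q a : eigenvalue A a ->
  normc q.[a] <= \sum_i \sum_j normc (horner_mx A q i j).
Proof.
move=> /eigenvalueP[v vA v0]; have vq := eigenvector_horner q vA.
pose j := [arg max_(j > ord0 : 'I_n.+1) normc (v 0 j)]%O.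
have jmax i : normc (v 0 i) <= normc (v 0 j).
  by rewrite /j; case: arg_maxP => // k _ /(_ i isT).
have vj : 0 < normc (v 0 j).
  rewrite lt_neqAle normc_ge0 andbT eq_sym; apply: contra v0 => /eqP vj0.
  apply/eqP/rowP => i; apply/eqP; rewrite mxE -normc_eq0 eq_le normc_ge0 andbT.
  by rewrite -vj0.
rewrite -(ler_pM2r vj) -normcM.
have -> : q.[a] * v 0 j = \sum_i v 0 i * horner_mx A q i j.
  by move/rowP: vq => /(_ j); rewrite !mxE => <-.
apply: le_trans (normc_sum _ _ _) _; rewrite big_distrl /=.
apply: ler_sum => i _; rewrite normcM mulrC; apply: ler_pM;
  rewrite ?normc_ge0 //.
by rewrite (bigD1 j) //= lerDl sumr_ge0 // => k _; exact: normc_ge0.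
Qed.

Lemma cdiff_horner_mx (F : R[i] -> 'M[R[i]]_n.+1) z q :
  (forall i j, cdiff (fun w => F w i j) z) ->
  forall i j, cdiff (fun w => horner_mx (F w) q i j) z.
Proof.
move=> dF; elim/poly_ind: q => [|q c IH] i j.
  by under eq_fun do rewrite rmorph0 mxE; exact: cdiff_cst.
under eq_fun do rewrite rmorphD rmorphM /= horner_mx_X horner_mx_C !mxE.
apply: cdiffD; last exact: cdiff_cst.
by apply: cdiff_sum => k; apply: cdiffM.
Qed.

(** The entries of q(F z) are differentiable and vanish at z0, so they are
    O(z - z0), and they dominate q at the eigenvalues of F z. For q the
    characteristic or minimal polynomial of F z0 this measures how fast the
    eigenvalues of F z approach those of F z0. *)
Lemma spectrum_near (F : R[i] -> 'M[R[i]]_n.+1) z0 q :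
  (forall i j, cdiff (fun w => F w i j) z0) -> horner_mx (F z0) q = 0 ->
  exists2 d : R, 0 < d & exists2 C : R, 0 <= C & forall z, normc (z - z0) < d ->
    forall x, eigenvalue (F z) x -> normc q.[x] <= C * normc (z - z0).
Proof.
move=> dF q0; have dH := cdiff_horner_mx q dF.
have [d d0 [C C0 H]] : exists2 d : R, 0 < d & exists2 C : R, 0 <= C &
    forall z, normc (z - z0) < d ->
    forall ij : 'I_n.+1 * 'I_n.+1,
      normc (horner_mx (F z) q ij.1 ij.2) <= C * normc (z - z0).
  suff [d d0 [C C0 H]] : exists2 d : R, 0 < d & exists2 C : R, 0 <= C &
      forall z, normc (z - z0) < d ->
        forall ij, ij \in enum {: 'I_n.+1 * 'I_n.+1} ->
      normc (horner_mx (F z) q ij.1 ij.2) <= C * normc (z - z0).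
    by exists d => //; exists C => // z zd ij; apply: H; rewrite ?mem_enum.
  elim: (enum _) => [|ij s [d d0 [C C0 H]]]; first by exists 1 => //; exists 0.
  have [d' d'0 [C' C'0 H']] := cdiff_lip (dH ij.1 ij.2).
  exists (Num.min d d'); first by rewrite lt_min d0.
  exists (C + C'); first by rewrite addr_ge0 // ltW.
  move=> z; rewrite lt_min => /andP[zd zd'] kl;
    rewrite inE mulrDl => /predU1P[->|kls].
    have := H' _ zd'; rewrite q0 mxE subr0 => /le_trans; apply.
    by rewrite lerDr mulr_ge0 // normc_ge0.
  apply: le_trans (H _ zd _ kls) _.
  by rewrite lerDl mulr_ge0 ?normc_ge0 // ltW.
exists d => //; exists (\sum_(i < n.+1) \sum_(j < n.+1) C).
  by do 2 apply: sumr_ge0 => ? _.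
move=> z zd x xe; apply: le_trans (horner_eigenvalue_bound q xe) _.
rewrite big_distrl /=; apply: ler_sum => i _; rewrite big_distrl /=.
by apply: ler_sum => j _; exact: (H z zd (i, j)).
Qed.

End MatrixSpectrum.

(** * Holomorphy of sums over the spectrum *)

Section SpectralSum.
Context {R : realType}.
Implicit Types (Omega : set R[i]) (h : R[i] -> R[i]) (a x z : R[i]).

Lemma open_disc Omega a : open (Omega : set (R[i])^o) -> Omega a ->
  exists2 d : R, 0 < d & forall w, normc (w - a) < d -> Omega w.
Proof.
move=> oO Oa; have /nbhs_ballP[e /= e0 He] := open_nbhs_nbhs (conj oO Oa).
have er : e = (Re e)%:C by rewrite RRe_real // gtr0_real.
exists (Re e); first by rewrite er ltcR in e0.
by move=> w wa; apply: He; rewrite /ball /= er norm_normc normcB ltcR.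
Qed.

Lemma taylor_at Omega h M a (L : nat) : open (Omega : set (R[i])^o) ->
  Omega a ->
  (forall w, Omega w -> cdiff h w) -> (forall w, Omega w -> normc (h w) <= M) ->
  exists q : {poly R[i]}, exists2 d : R, 0 < d & exists2 K : R, 0 <= K &
    forall x, normc (x - a) < d ->
      normc (h x - q.[x]) <= K * normc (x - a) ^+ L.
Proof.
move=> oO Oa dh hM; have [rho rho0 Hr] := open_disc oO Oa.
have Oz z : normc z < rho -> Omega (z + a) by move=> zr; apply: Hr;
  rewrite addrK.
have [||q [d d0 [K K0 H]]] := @taylor_bound _ rho (fun z => h (z + a)) M L rho0.
- move=> w wr; apply: (@cdiff_comp _ (fun z => z + a)); last exact/dh/Oz.
  by apply: cdiffD; [exact: cdiff_id|exact: cdiff_cst].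
- by move=> w /Oz; exact: hM.
exists (q \Po ('X - a%:P)), d => //; exists K => // x xd.
by rewrite horner_comp !hornerE; have := H _ xd; rewrite subrK.
Qed.

(** Taylor polynomials at the points of s are glued by the Chinese remainder
    theorem: changing q a by a multiple of (X - a) ^ L does not affect the
    order of contact at a. *)
Lemma hermite Omega h M (L : nat) (s : seq R[i]) :
  open (Omega : set (R[i])^o) ->
  (forall a, a \in s -> Omega a) ->
  (forall w, Omega w -> cdiff h w) -> (forall w, Omega w -> normc (h w) <= M) ->
  exists Q : {poly R[i]}, exists2 d : R, 0 < d & exists2 K : R, 0 <= K &
    forall a, a \in s -> forall x, normc (x - a) < d ->
      normc (h x - Q.[x]) <= K * normc (x - a) ^+ L.
Proof.
move=> oO sO dh hM.
have /choice[q Hq] : forall a, exists q : {poly R[i]}, a \in s ->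
    exists2 d : R, 0 < d & exists2 K : R, 0 <= K &
    forall x, normc (x - a) < d ->
      normc (h x - q.[x]) <= K * normc (x - a) ^+ L.
  move=> a; have [as_|_] := boolP (a \in s); last by exists 0.
  by have [q Hq] := taylor_at L oO (sO _ as_) dh hM; exists q.
have [Q HQ] := poly_crt L q (undup_uniq s).
exists Q.
have {HQ}loc a : a \in s -> exists2 d : R, 0 < d & exists2 K : R, 0 <= K &
    forall x, normc (x - a) < d ->
      normc (h x - Q.[x]) <= K * normc (x - a) ^+ L.
  move=> as_; have [d d0 [K K0 H]] := Hq _ as_.
  have /dvdpP[g Hg] : ('X - a%:P) ^+ L %| Q - q a by apply: HQ;
    rewrite mem_undup.
  have /contP/(_ _ ltr01)[d' d'0 H'] := cdiff_cont (cdiff_horner g a).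
  exists (Num.min d d'); first by rewrite lt_min d0.
  exists (K + (normc g.[a] + 1)); first by rewrite !addr_ge0 ?normc_ge0.
  move=> x; rewrite lt_min => /andP[xd xd'].
  have -> : h x - Q.[x] = (h x - (q a).[x]) - g.[x] * (x - a) ^+ L.
    have -> : g.[x] * (x - a) ^+ L = (Q - q a).[x] by rewrite Hg !hornerE.
    by rewrite !hornerE; ring.
  apply: le_trans (le_normcD _ _) _; rewrite normcN normcM normcX mulrDl.
  apply: lerD; first exact: H.
  apply: ler_wpM2r; first by rewrite exprn_ge0 // normc_ge0.
  rewrite -lerBlDl; apply: le_trans (ler_normcB _ _) _.
  exact/ltW/H'.
elim: s {sO Hq} loc => [_|b s IH loc]; first by exists 1 => //; exists 0.
have [|d d0 [K K0 H]] := IH; first by move=> a as_; apply: loc;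
  rewrite inE as_ orbT.
have [|d' d'0 [K' K'0 H']] := loc b; first exact: mem_head.
exists (Num.min d d'); first by rewrite lt_min d0.
exists (K + K'); first by rewrite addr_ge0.
move=> a; rewrite inE => /predU1P[->|as_] x; rewrite lt_min => /andP[xd xd'].
  apply: le_trans (H' _ xd') _; rewrite mulrDl lerDr.
  by rewrite mulr_ge0 // exprn_ge0 // normc_ge0.
apply: le_trans (H _ as_ _ xd) _; rewrite mulrDl lerDl.
by rewrite mulr_ge0 // exprn_ge0 // normc_ge0.
Qed.

(** Let Q interpolate h to order n + 2 at the eigenvalues of the matrix F z0
    of size n + 1. The trace of Q(F z) is differentiable, and it differs from
    the sum of h by the sum of h - Q. An eigenvalue x of F z has an eigenvalue
    a of F z0 with |x - a| ^ (n + 1) = O(|z - z0|), so that sum is O(|x - a| ^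
    (n + 2)) = o(|z - z0|). This replaces holomorphic functional calculus. *)
Lemma cdiff_spectral_sum n Omega h M (F : R[i] -> 'M[R[i]]_n.+1) z0 :
  open (Omega : set (R[i])^o) ->
  (forall w, Omega w -> cdiff h w) -> (forall w, Omega w -> normc (h w) <= M) ->
  (forall i j, cdiff (fun w => F w i j) z0) ->
  (forall x, eigenvalue (F z0) x -> Omega x) ->
  cdiff (fun z => \sum_(x <- spec (F z)) h x) z0.
Proof.
move=> oO dh hM dF FO; pose N := n.+1.
have [|Q [d d0 [K K0 HQ]]] := @hermite Omega h M N.+1 (spec (F z0)) oO _ dh hM.
  by move=> a; rewrite mem_spec; exact: FO.
have [d1 d10 [C C0 HC]] := spectrum_near dF (Cayley_Hamilton (F z0)).
have dtr : cdiff (fun z => \tr (horner_mx (F z) Q)) z0.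
  by apply: cdiff_sum => i; exact: cdiff_horner_mx.
pose g z := \sum_(x <- spec (F z)) (h x - Q.[x]).
have -> : (fun z => \sum_(x <- spec (F z)) h x) = fun z =>
  \tr (horner_mx (F z) Q) + g z.
  apply/funext => z; rewrite trace_horner_mx -big_split /=.
  by apply: eq_bigr => x _; rewrite addrC subrK.
apply: cdiffD => //; apply: (@cdiff_eps _ _ _ 0) => e e0.
have g0 : g z0 = 0.
  rewrite /g big_seq big1 // => x xs; apply: eq0_normc; apply/eqP.
  rewrite eq_le normc_ge0 andbT; apply: le_trans (HQ _ xs x _) _.
    by rewrite subrr normc0.
  by rewrite subrr normc0 expr0n mulr0.
pose KC := N%:R * K * C + 1; have KC0 : 0 < KC.
  by rewrite ltr_wpDl // !mulr_ge0.
pose d2 := Num.min d (e / KC).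
have d20 : 0 < d2 by rewrite lt_min d0 divr_gt0.
exists (Num.min d1 (d2 ^+ N / (C + 1))).
  by rewrite lt_min d10 divr_gt0 ?exprn_gt0 // ltr_wpDl.
move=> z; rewrite lt_min => /andP[zd1 zd2]; rewrite g0 subr0 mul0r subr0.
have z0' := normc_ge0 (z - z0).
have Hx x : x \in spec (F z) ->
    normc (h x - Q.[x]) <= K * (C * normc (z - z0)) * (e / KC).
  rewrite mem_spec => xe; have Hc := HC _ zd1 _ xe.
  have [|a as_] := horner_prod_XsubC_min (r := spec (F z0)) x.
    by rewrite size_spec.
  rewrite -spec_prod size_spec => Ha.
  have xaN : normc (x - a) ^+ N <= C * normc (z - z0) by exact: le_trans Ha Hc.
  have xa2 : normc (x - a) < d2.
    rewrite -(@ltr_pXn2r _ N) ?nnegrE ?normc_ge0 ?(ltW d20) //.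
    apply: le_lt_trans xaN _.
    rewrite ltr_pdivlMr ?ltr_wpDl // in zd2.
    by apply: le_lt_trans zd2; rewrite mulrC ler_wpM2l // lerDl.
  have [xad xae] : normc (x - a) < d /\ normc (x - a) < e / KC.
    by move: xa2; rewrite lt_min => /andP[].
  apply: le_trans (HQ _ as_ _ xad) _; rewrite exprSr -mulrA mulrA.
  rewrite -mulrA mulrA -!mulrA ler_wpM2l // mulrA.
  apply: ler_pM; rewrite ?exprn_ge0 ?normc_ge0 //; exact: ltW.
apply: le_trans (normc_sum _ _ _) _.
apply: (@le_trans _ _ (\sum_(x <- spec (F z)) K * (C * normc (z - z0)) * (e /
  KC))).
  by rewrite !big_seq; apply: ler_sum.
rewrite big_const_seq count_predT size_spec iter_addr_0 -mulr_natl -/N.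
have -> : N%:R * (K * (C * normc (z - z0)) * (e / KC)) =
   (N%:R * K * C / KC) * (e * normc (z - z0)) by ring.
rewrite ler_piMl ?mulr_ge0 ?(ltW e0) //.
by rewrite ler_pdivrMr // mul1r /KC lerDl.
Qed.

End SpectralSum.

(** * The Schwarz lemma for spectra *)

Section Moebius.
Context {R : realType}.
Implicit Types (a b z w : R[i]).

Lemma sqr_normcE z : normc z ^+ 2 = Re z ^+ 2 + Im z ^+ 2.
Proof. by case: z => x y; rewrite /= sqr_sqrtr // addr_ge0 ?sqr_ge0. Qed.

Lemma moebius_den_neq0 a b : normc a < 1 -> normc b < 1 -> 1 - a^*%C * b != 0.
Proof.
move=> a1 b1; rewrite -normc_gt0.
have := ler_normcB 1 (a^*%C * b); rewrite normc1 normcM normcConj.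
apply: lt_le_trans; rewrite subr_gt0.
by apply: mulr_ilt1; rewrite ?normc_ge0.
Qed.

(** Because |1 - a^* b| ^ 2 - |b - a| ^ 2 = (1 - |a| ^ 2) (1 - |b| ^ 2). *)
Lemma moebius_lt1 a b : normc a < 1 -> normc b < 1 ->
  normc ((b - a) / (1 - a^*%C * b)) < 1.
Proof.
move=> a1 b1; have d0 := moebius_den_neq0 a1 b1.
rewrite normcM normcV ltr_pdivrMr ?normc_gt0 // mul1r.
rewrite -(@ltr_pXn2r _ 2) ?nnegrE ?normc_ge0 // !sqr_normcE -subr_gt0.
have a2 : 0 < 1 - (Re a ^+ 2 + Im a ^+ 2).
  by rewrite -sqr_normcE subr_gt0 expr_lt1 // normc_ge0.
have b2 : 0 < 1 - (Re b ^+ 2 + Im b ^+ 2).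
  by rewrite -sqr_normcE subr_gt0 expr_lt1 // normc_ge0.
have := mulr_gt0 a2 b2; congr (_ < _).
by case: a b {a1 b1 d0 a2 b2} => x y [u v] /=; ring.
Qed.

Lemma cdiff_moebius (f : R[i] -> R[i]) a w : normc a < 1 -> normc (f w) < 1 ->
  cdiff f w -> cdiff (fun w => (f w - a) / (1 - a^*%C * f w)) w.
Proof.
move=> a1 f1 df; apply: cdiffM; first by apply: cdiffB => //; exact: cdiff_cst.
apply: cdiffV; first exact: moebius_den_neq0.
by apply: cdiffB; [exact: cdiff_cst|apply: cdiffM => //; exact: cdiff_cst].
Qed.

End Moebius.

Section SpectralSchwarz.
Context {R : realType}.

(** Each factor satisfies |g a w| <= K |w - a| on the whole of Omega: near a
    because g a is differentiable and vanishes there, away from a because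
    |g a w| <= 1. *)
Lemma blaschke_bound (Omega : set R[i]) (s : seq R[i]) (m : R[i] -> nat)
    (g : R[i] -> R[i] -> R[i]) :
  (forall a, a \in s -> [/\ cdiff (g a) a, g a a = 0 &
    forall w, Omega w -> normc (g a w) <= 1]) ->
  exists2 K : R, 0 <= K & forall w, Omega w ->
    normc (\prod_(a <- s) g a w ^+ m a) <=
    K * normc (\prod_(a <- s) ('X - a%:P) ^+ m a).[w].
Proof.
move=> Hg; elim: s Hg => [_|a s IH Hg].
  by exists 1 => // w _; rewrite !big_nil hornerC mul1r.
have [|K K0 HK] := IH; first by move=> b bs; apply: Hg; rewrite inE bs orbT.
have [dg ga0 g1] := Hg a (mem_head _ _).
have [d d0 [L L0 HL]] := cdiff_lip dg.
have lin w : Omega w -> normc (g a w) <= (L + d^-1) * normc (w - a).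
  move=> Ow; rewrite mulrDl; have [wd|dw] := ltP (normc (w - a)) d.
    have := HL _ wd; rewrite ga0 subr0 => /le_trans; apply.
    by rewrite lerDl mulr_ge0 ?normc_ge0 // invr_ge0 ltW.
  apply: le_trans (g1 _ Ow) _; apply: ler_wpDl.
    by rewrite mulr_ge0 ?normc_ge0 // ltW.
  by rewrite mulrC ler_pdivlMr // mul1r.
exists ((L + d^-1) ^+ m a * K).
  by rewrite mulr_ge0 // exprn_ge0 // addr_ge0 ?invr_ge0 // ltW.
move=> w Ow; rewrite !big_cons hornerM !normcM horner_exp !normcX.
rewrite mulrACA -exprMn hornerXsubC; apply: ler_pM;
  rewrite ?exprn_ge0 ?normc_ge0 //.
  by apply: lerXn2r; rewrite ?nnegrE ?normc_ge0 ?(le_trans (normc_ge0 _) (lin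
    _ Ow)) // lin.
exact: HK.
Qed.

(** The product B of the g a, with the multiplicities of the minimal
    polynomial q of F 0, satisfies |B| <= K |q| on Omega, so B is O(z) on the
    spectrum of F z. Its power sums p k over that spectrum are therefore
    holomorphic functions on the disc, bounded by the size of the matrices and
    O(z ^ (k + 1)). As in Schwarz's lemma, p k c is at most D (|c| / r) ^ k
    for |c| < r < 1, with D independent of k, and this bounds each |B mu|. *)
Lemma spectral_schwarz0 n (Omega : set R[i]) (F : R[i] -> 'M[R[i]]_n.+1)
    (s : seq R[i]) (g : R[i] -> R[i] -> R[i]) (c mu : R[i]) :
  open (Omega : set (R[i])^o) ->
  (forall z, normc z < 1 -> forall i j, cdiff (fun w => F w i j) z) ->
  (forall z, normc z < 1 -> forall x, eigenvalue (F z) x -> Omega x) ->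
  uniq s -> (forall x, (x \in s) = eigenvalue (F 0) x) ->
  (forall a, a \in s -> [/\ forall w, Omega w -> cdiff (g a) w, g a a = 0 &
    forall w, Omega w -> normc (g a w) <= 1]) ->
  normc c < 1 -> eigenvalue (F c) mu ->
  \prod_(a <- s) normc (g a mu) ^+ mup a (mxminpoly (F 0)) <= normc c.
Proof.
move=> oO dF FO us sE Hg c1 mue.
pose m a := mup a (mxminpoly (F 0)).
pose B w := \prod_(a <- s) g a w ^+ m a.
have n0 : normc (0 : R[i]) < 1 by rewrite normc0.
have sO a : a \in s -> Omega a by rewrite sE; exact: FO.
have Bdif w : Omega w -> cdiff B w.
  move=> Ow; rewrite /B; under eq_fun do rewrite big_seq.
  under eq_fun do rewrite big_mkcond /=.
  apply: (@cdiff_prod _ _ s (fun a x =>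
    if a \in s then g a x ^+ m a else 1)) => a.
  case: (boolP (a \in s)) => [as_|_]; last exact: cdiff_cst.
  by apply: cdiffX; have [H _ _] := Hg _ as_; exact: H.
have B1 w : Omega w -> normc (B w) <= 1.
  move=> Ow; rewrite /B normc_prod big_seq.
  apply: (@le_trans _ _ (\prod_(a <- s | a \in s) (1 : R)));
    last by rewrite big1.
  apply: ler_prod => a as_; rewrite normc_ge0 normcX /=.
  by apply: exprn_ile1; [exact: normc_ge0|have [_ _ H] := Hg _ as_; exact: H].
have qE : mxminpoly (F 0) = \prod_(a <- s) ('X - a%:P) ^+ m a.
  apply: prod_mup => //; first exact: mxminpoly_monic.
  by move=> x; rewrite root_mxminpoly -eigenvalue_root_char sE.
have [K K0 HK] : exists2 K : R, 0 <= K & forall w, Omega w ->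
    normc (B w) <= K * normc (mxminpoly (F 0)).[w].
  rewrite qE; apply: blaschke_bound => a as_; have [H1 H2 H3] := Hg _ as_.
  by split => //; apply: H1; exact: sO.
have [d d0 [C C0 HC]] := spectrum_near (dF 0 n0) (mx_root_minpoly (F 0)).
pose A := K * C; have A0 : 0 <= A by rewrite mulr_ge0.
have BA z x : normc z < 1 -> normc z < d -> eigenvalue (F z) x ->
    normc (B x) <= A * normc z.
  move=> z1 zd xe; apply: le_trans (HK _ (FO _ z1 _ xe)) _.
  rewrite /A -mulrA ler_wpM2l //; have := HC z; rewrite subr0 => H.
  exact: H.
pose p k z := \sum_(x <- spec (F z)) B x ^+ k.+1.
have pdif k z : normc z < 1 -> cdiff (p k) z.
  move=> z1; apply: (@cdiff_spectral_sum _ _ Omega (fun x =>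
    B x ^+ k.+1) 1) => //.
  - by move=> w Ow; apply: cdiffX; exact: Bdif.
  - by move=> w Ow; rewrite normcX; apply: exprn_ile1;
    [exact: normc_ge0|exact: B1].
  - exact: dF.
  - exact: FO.
have psum k z M : 0 <= M -> normc z < 1 ->
    (forall x, eigenvalue (F z) x -> normc (B x) <= M) ->
    normc (p k z) <= n.+1%:R * M ^+ k.+1.
  move=> M0 z1 HM; apply: le_trans (normc_sum _ _ _) _.
  have -> : n.+1%:R * M ^+ k.+1 = \sum_(x <- spec (F z)) M ^+ k.+1.
    by rewrite big_const_seq count_predT size_spec iter_addr_0 mulr_natl.
  rewrite !big_seq; apply: ler_sum => x; rewrite mem_spec => xe.
  by rewrite normcX; apply: lerXn2r; rewrite ?nnegrE ?normc_ge0 // HM.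
have p1 k z : normc z < 1 -> normc (p k z) <= n.+1%:R.
  move=> z1; have := @psum k z 1 ler01 z1; rewrite expr1n mulr1; apply.
  by move=> x xe; apply: B1; exact: FO xe.
have p2 k z : normc z < 1 -> normc z < d ->
    normc (p k z) <= n.+1%:R * (A * normc z) ^+ k.+1.
  move=> z1 zd; apply: psum => //; first by rewrite mulr_ge0 ?normc_ge0.
  by move=> x; exact: BA.
(* The quotient by z ^ k, one power below the order of vanishing of p k, tends
   to 0 at 0; so it is continuous there, which is all that Cauchy's formula
   asks for. *)
pose H k z := if z == 0 then 0 else p k z / z ^+ k.
have HE k z : z != 0 -> forall w, normc (w - z) < normc z ->
  p k w / w ^+ k = H k w.
  move=> z0 w wz; rewrite /H; case: eqVneq wz => // ->.
  by rewrite sub0r normcN ltxx.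
have Hdif k z : normc z < 1 -> z != 0 -> cdiff (H k) z.
  move=> z1 z0; have z0' : 0 < normc z by rewrite normc_gt0.
  apply: (cdiff_near z0' (HE k z z0)); apply: cdiffM; first exact: pdif.
  by apply: cdiffV; [rewrite expf_neq0|apply: cdiffX; exact: cdiff_id].
have Hcont k : cont_disc 1 (H k).
  move=> z z1; have [->|z0] := eqVneq z 0; last exact/cdiff_cont/Hdif.
  apply/contP => e e0; pose E := n.+1%:R * A ^+ k.+1.
  have E0 : 0 <= E by rewrite mulr_ge0 // exprn_ge0.
  exists (Num.min (Num.min 1 d) (e / (E + 1))).
    by rewrite !lt_min ltr01 d0 divr_gt0 // ltr_wpDl.
  move=> w; rewrite subr0 !lt_min => /andP[/andP[w1 wd] we].
  rewrite {2}/H eqxx subr0 /H; case: eqVneq => [_|w0]; first by rewrite normc0.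
  rewrite normcM normcV normcX ltr_pdivrMr ?exprn_gt0 ?normc_gt0 //.
  apply: le_lt_trans (p2 _ _ w1 wd) _; rewrite exprMn mulrA -/E exprS mulrA.
  rewrite ltr_pM2r ?exprn_gt0 ?normc_gt0 //.
  rewrite ltr_pdivlMr ?ltr_wpDl // in we.
  apply: le_lt_trans we; rewrite mulrC ler_wpM2l ?normc_ge0 // lerDl //.
have pH k : p k c = H k c * c ^+ k.
  rewrite /H; case: eqVneq => [->|c0]; last by rewrite divfK // expf_neq0.
  rewrite mul0r; apply: eq0_normc; apply/eqP; rewrite eq_le normc_ge0 andbT.
  have := p2 k 0; rewrite normc0 mulr0 expr0n mulr0.
  by apply.
have Hr r : normc c < r < 1 -> normc (B mu) <= normc c / r.
  move=> /andP[cr r1]; have r0 : 0 < r by exact: le_lt_trans (normc_ge0 _) cr.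
  pose D : R := 2 * (n.+1%:R * (r / (r - normc c))).
  apply: (@power_sum_bound _ [seq B x | x <- spec (F c)] D).
  - by rewrite divr_ge0 ?normc_ge0 // ltW.
  - move=> k; rewrite big_map -/(p k c) pH normcM normcX expr_div_n.
    have : normc (H k c) <= 2 * (n.+1%:R / r ^+ k * (r / (r - normc c))).
      apply: (@cauchy_estimate _ 1) => // [w w1 w0|w wr]; first exact: Hdif.
      rewrite /H; case: eqVneq => [_|w0].
        by rewrite normc0 divr_ge0 // exprn_ge0 // ltW.
      rewrite normcM normcV normcX wr ler_pM2r ?invr_gt0 ?exprn_gt0 //.
      by apply: p1; rewrite wr.
    move=> Hk; have ck : 0 <= normc c ^+ k by rewrite exprn_ge0 // normc_ge0.
    apply: le_trans (ler_wpM2r ck Hk) _; rewrite le_eqVlt; apply/orP; left.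
    by apply/eqP; rewrite /D; ring.
  by apply/mapP; exists mu => //; rewrite mem_spec.
have BE : normc (B mu) = \prod_(a <- s) normc (g a mu) ^+ m a.
  by rewrite /B normc_prod; apply: eq_bigr => a _; rewrite normcX.
(* If |c| < |B mu|, the radius halfway between |c| / |B mu| and 1 contradicts
   Hr. *)
rewrite -BE leNgt; apply/negP => cB.
have B1' : normc (B mu) <= 1 by apply: B1; exact: FO mue.
have B0 : 0 < normc (B mu) by exact: le_lt_trans (normc_ge0 _) cB.
pose q := normc c / normc (B mu).
have q1 : q < 1 by rewrite /q ltr_pdivrMr // mul1r.
have cq : normc c <= q by rewrite /q ler_pdivlMr // ler_piMr // normc_ge0.
have cqB : normc c = q * normc (B mu) by rewrite /q divfK // gt_eqF.
have qr : q < (q + 1) / 2 < 1 by lra.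
have /Hr : normc c < (q + 1) / 2 < 1 by lra.
have r0 : 0 < (q + 1) / 2 by have := normc_ge0 c; lra.
rewrite ler_pdivlMr // cqB mulrC ler_pM2r //.
by lra.
Qed.

End SpectralSchwarz.

(** * Suprema and the Caratheodory distance *)

Section Supremum.
Context {R : realType} {T : eqType}.

(** By continuity of t |-> c t ^ k, a strict inequality at the supremum would
    already hold at some element of S. *)
Lemma sup_expr_le (S : set R) (c M : R) (k : nat) : has_sup S ->
  (forall y, S y -> c * y ^+ k <= M) -> c * sup S ^+ k <= M.
Proof.
move=> hS SM; rewrite leNgt; apply/negP => Mlt.
have cf : {for sup S, continuous (fun t : R => c * t ^+ k)}.
  by apply: cvgMl_tmp; exact: exprn_continuous.
have : \forall t \near sup S, M < c * t ^+ k.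
  exact: (@cvgr_gt _ _ (nbhs (sup S)) _ _ _ cf M Mlt).
move=> /nbhs_ballP[e /= e0 He].
have [y Sy ye] := sup_adherent e0 hS.
have /He : ball (sup S) e y.
  rewrite /ball /= ger0_norm; first by rewrite ltrBlDl -ltrBlDr.
  by rewrite subr_ge0; apply: ub_le_sup Sy; case: hS.
by rewrite /= ltNge SM.
Qed.

(** The suprema are taken one factor at a time, all the other factors being
    absorbed into a constant. *)
Lemma prod_sup_le (s : seq T) (m : T -> nat) (S : T ->
  set R) (M : R) : uniq s ->
  (forall a, a \in s -> has_sup (S a)) ->
  (forall x : T -> R, (forall a, a \in s -> S a (x a)) ->
     \prod_(a <- s) x a ^+ m a <= M) ->
  \prod_(a <- s) sup (S a) ^+ m a <= M.
Proof.
move=> us hS H; suff gen (c : R) : (forall x : T -> R,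
    (forall a, a \in s -> S a (x a)) -> c * \prod_(a <- s) x a ^+ m a <= M) ->
    c * \prod_(a <- s) sup (S a) ^+ m a <= M.
  by rewrite -[leLHS]mul1r; apply: gen => x xS; rewrite mul1r; exact: H.
elim: s us hS c {H} => [|b s IH] /= => [_ _|/andP[bs us] hS] c H.
  by have := H (fun=> 0); rewrite !big_nil; apply.
rewrite big_cons mulrA; apply: IH => // [a as_|x xS].
  by apply: hS; rewrite inE as_ orbT.
rewrite mulrAC; apply: sup_expr_le => [|y Sy]; first exact/hS/mem_head.
have := H (fun a => if a == b then y else x a).
rewrite big_cons eqxx [\prod_(j <- s) _ in X in X ->
  _](_ : _ = \prod_(a <- s) x a ^+ m a).
  rewrite mulrA mulrAC; apply=> a; rewrite inE; case: eqVneq => [->//|_] /=.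
  exact: xS.
rewrite !big_seq; apply: eq_bigr => a as_; case: eqVneq => // ab.
by rewrite -ab as_ in bs.
Qed.

End Supremum.

Section Caratheodory.
Context {R : realType}.
Implicit Types (Omega : set R[i]) (z w : R[i]).

Lemma mobius_distC z w : mobius_dist z w = mobius_dist w z.
Proof.
rewrite /mobius_dist !normcM !normcV normcB -[X in _ / X]normcConj.
by congr (_ / normc _); rewrite !rmorphB !rmorphM !rmorph1 /= mulrC conjcK.
Qed.

Lemma mem_eigenvalues n (A : 'M[R[i]]_n) x :
  (x \in (eigenvalues A : seq _)) = eigenvalue A x.
Proof.
by rewrite in_fset_set; [apply/idP/idP; rewrite in_setE|exact: finite_spectrum].
Qed.

(** The competitor 0 gives a point of the set, and Moebius distances in the
    disc are below 1. *)
Lemma caratheodory_has_sup Omega p q : Omega p -> Omega q ->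
  has_sup [set mobius_dist (f p) (f q) | f in
    [set f : R[i] -> (R[i])^o |
      holomorphic_on Omega f /\ f @` Omega `<=` unit_disc R]].
Proof.
move=> Op Oq; split.
  exists (mobius_dist (0 : R[i]) 0), (fun=> 0) => //; split.
    by move=> z _; exact: derivable_cst.
  by move=> _ [z _ <-]; rewrite /unit_disc /= normr0.
exists 1 => _ [f [_ fO] <-]; apply/ltW; apply: moebius_lt1.
  by have := fO _ (ex_intro2 _ _ q Oq erefl);
    rewrite /unit_disc /= norm_normc ltcR.
by have := fO _ (ex_intro2 _ _ p Op erefl);
  rewrite /unit_disc /= norm_normc ltcR.
Qed.

(** Precomposing F with the automorphism psi of the disc that sends 0 to zeta1
    and c to zeta2 reduces the claim to zeta1 = 0; postcomposing each
    competitor f a with the automorphism that sends f a a to 0 turns the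
    Moebius distance into the modulus of g a. *)
Lemma spectral_schwarz n Omega (F : R[i] ->
  'M[R[i]]_n.+1) (zeta1 zeta2 mu : R[i]) :
  open (Omega : set (R[i])^o) ->
  holomorphic_on (unit_disc R) F -> F @` unit_disc R `<=` S_ n.+1 Omega ->
  unit_disc R zeta1 -> unit_disc R zeta2 ->
  eigenvalue (F zeta2) mu ->
  \prod_(lambda <- eigenvalues (F zeta1))
    caratheodory Omega mu lambda ^+ minpoly_mult (F zeta1) lambda
  <= mobius_dist zeta1 zeta2.
Proof.
move=> oO holF FS z1 z2 mue.
have disc z : unit_disc R z -> normc z < 1
  by rewrite /unit_disc /= norm_normc ltcR.
have disc' z : normc z < 1 -> unit_disc R z
  by rewrite /unit_disc /= norm_normc ltcR.
have z1' := disc _ z1; have z2' := disc _ z2.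
have FO z : normc z < 1 -> forall x, eigenvalue (F z) x -> Omega x.
  move=> /disc' zd x; exact: (FS _ (ex_intro2 _ _ z zd erefl)).
apply: prod_sup_le; first exact: fset_uniq.
  move=> a; rewrite mem_eigenvalues => ae.
  by apply: caratheodory_has_sup; [exact: FO z2' _ mue|exact: FO z1' _ ae].
move=> x Hx.
have /choice[f Hf] : forall a, exists f : R[i] -> (R[i])^o,
    a \in (eigenvalues (F zeta1) : seq _) ->
    [/\ holomorphic_on Omega f, f @` Omega `<=` unit_disc R &
      mobius_dist (f mu) (f a) = x a].
  move=> a; have [as_|_] := boolP (a \in (eigenvalues (F zeta1) : seq _)).
    by have [f [fh fO] fE] := Hx _ as_; exists f.
  by exists (fun=> 0).
pose k := zeta1^*%C; pose c := (zeta2 - zeta1) / (1 - k * zeta2).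
have nz1 : normc (- zeta1) < 1 by rewrite normcN.
pose psi z := (z - - zeta1) / (1 - (- zeta1)^*%C * z).
have psi0 : psi 0 = zeta1 by rewrite /psi mulr0 subr0 divr1 add0r opprK.
have c1 : normc c < 1 by exact: moebius_lt1.
have psic : psi c = zeta2.
  have d1 := moebius_den_neq0 z1' z2'; have d2 := moebius_den_neq0 z1' z1'.
  have d3 := moebius_den_neq0 nz1 c1; rewrite rmorphN /= in d3.
  rewrite /psi rmorphN /=; move: d1 d2 d3; rewrite /c -/k.
  move=> d1 d2 d3; apply: (mulIf d3); rewrite divfK //.
  by field.
have psi1 z : normc z < 1 -> normc (psi z) < 1.
  by move=> zd; exact: moebius_lt1.
rewrite mobius_distC /mobius_dist -[X in normc X]/c.
pose g a w := (f a w - f a a) / (1 - (f a a)^*%C * f a w).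
have Ofd a w : a \in (eigenvalues (F zeta1) : seq _) -> Omega w ->
  normc (f a w) < 1.
  move=> /Hf[_ fO _] Ow; apply: disc; apply: fO; by exists w.
have := @spectral_schwarz0 _ n Omega (fun z => F (psi z))
  (eigenvalues (F zeta1)) g c mu oO.
rewrite psi0 psic => H.
rewrite (@eq_big_seq _ _ _ _ _ (fun a => x a ^+ minpoly_mult (F zeta1) a)
   (fun a => normc (g a mu) ^+ mup a (mxminpoly (F zeta1)))); last first.
  by move=> a as_; have [_ _ <-] := Hf _ as_.
apply: H; [| | | | |exact: c1|exact: mue].
- move=> z zd i j; apply: (@cdiff_comp _ psi (fun w => F w i j)).
    exact: (cdiff_moebius nz1 zd (cdiff_id z)).
  by apply: derivable_mx_entry; apply: holF; apply: disc'; exact: psi1.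
- by move=> z zd y; apply: FO; exact: psi1.
- exact: fset_uniq.
- by move=> y; rewrite mem_eigenvalues.
move=> a as_; have Oa : Omega a by apply: (FO _ z1'); rewrite -mem_eigenvalues.
split.
- move=> w Ow; apply: cdiff_moebius; [exact: Ofd|exact: Ofd|].
  by apply: derivable_cdiff; have [fh _ _] := Hf _ as_; exact: fh.
- by rewrite /g subrr mul0r.
- by move=> w Ow; apply/ltW/moebius_lt1; exact: Ofd.
Qed.

End Caratheodory.

Theorem theorem1p7 (R : realType) (Omega : set R[i])
    (Omega_domain : is_domain Omega)
    (Omega_hyp : caratheodory_hyperbolic Omega)
    (n : nat) (F : R[i] -> 'M[R[i]]_n.+2)
    (F_holo : holomorphic_on (unit_disc R) F)
    (F_maps : F @` unit_disc R `<=` S_ n.+2 Omega)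
    (zeta1 zeta2 : R[i])
    (zeta1_disc : unit_disc R zeta1) (zeta2_disc : unit_disc R zeta2) :
  let W1 := F zeta1 in
  let W2 := F zeta2 in
  Num.max
    (* the maxima are over nonempty sets of nonnegative reals *)
    (\big[Num.max/0]_(mu <- eigenvalues W2)
       \prod_(lambda <- eigenvalues W1)
         caratheodory Omega mu lambda ^+ minpoly_mult W1 lambda)
    (\big[Num.max/0]_(lambda <- eigenvalues W1)
       \prod_(mu <- eigenvalues W2)
         caratheodory Omega lambda mu ^+ minpoly_mult W2 mu)
  <= mobius_dist zeta1 zeta2.
Proof.
cbv zeta; have [_ oO _] := Omega_domain.
have M0 : 0 <= mobius_dist zeta1 zeta2 by exact: normc_ge0.
rewrite ge_max; apply/andP; split; rewrite big_seq; apply: bigmax_le => // a.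
  by rewrite mem_eigenvalues; exact: spectral_schwarz.
by rewrite mem_eigenvalues mobius_distC; exact: spectral_schwarz.
Qed.
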